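(* Let $\mathfrak g$ be one of the DG Lie algebras $\mathcal T_{poly}^{\cdot}[1](M)$ or $\mathcal D_{poly}^{\cdot}[1](M)$ of a smooth manifold $M$, let $\pi\in\mathfrak g$ be a Maurer-Cartan element, and let $\mathscr X=\{X_n\}_{n\ge1}$ be an $L_\infty$-derivation of $\mathfrak g$ which verifies the weak $L_\infty$-Nijenhuis property with respect to $\pi$, i.e. $\mathscr X_\pi(\mathscr X(\pi))=0$. If $f,g\in\mathfrak g^{-1}$ satisfy $d_\pi f=d_\pi g=0$, then $$\{\mathscr X_\pi(f),\mathscr X_\pi(g)\}=0.$$
   Context: The ground field has characteristic $0$ ($\mathbb R$ or $\mathbb C$). All infinite series below are assumed to converge in $\mathfrak g$ (for instance because one works with coefficients extended to formal power series in $\hbar$ and $\pi$ is divisible by $\hbar$). The two DG Lie algebras. $\mathcal T_{poly}^{\cdot}[1](M)$ is the graded Lie algebra of polyvector fields on $M$ with the Schouten bracket and zero differential, where $p$-vector fields have degree $p-1$. $\mathcal D_{poly}^{\cdot}[1](M)$ is the DG Lie algebra of local Hochschild cochains (polydifferential operators) of $C^\infty(M)$, with the Hochschild differential and the Gerstenhaber bracket, where $p$-cochains have degree $p-1$. In both cases the lowest degree is $-1$, the degree $-1$ part $\mathfrak g^{-1}$ consists of the functions on $M$, the differential $d$ vanishes on $\mathfrak g^{-1}$, and $[\mathfrak g^{-1},\mathfrak g^{-1}]=0$. A Maurer-Cartan element is $\pi\in\mathfrak g$ of degree $1$ with $d\pi+\frac12[\pi,\pi]=0$. Put $d_\pi(a)=da+[\pi,a]$.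 For $f,g\in\mathfrak g^{-1}$ put $\{f,g\}=[f,[\pi,g]]=[f,d_\pi g]$ (for $\mathcal T_{poly}$ this is the Poisson bracket of the bivector $\pi$; for $\mathcal D_{poly}$ it is the commutator $f\star g-g\star f$ of the deformed product determined by $\pi$). $L_\infty$-derivations. Let $\Lambda_{\mathfrak g}=\Lambda^*(\mathfrak g[1])$ be the free graded cocommutative coalgebra with the codifferential $D$ whose Taylor coefficients are $D_1=d$, $D_2=[\,,]$, $D_n=0$ for $n\ge3$. An $L_\infty$-derivation of $\mathfrak g$ is a degree $0$ linear map $\mathscr X:\Lambda_{\mathfrak g}\to\Lambda_{\mathfrak g}$ which is a coderivation of the free coalgebra and commutes with $D$. It is determined by its Taylor coefficients $X_n:\wedge^n\mathfrak g\to\mathfrak g$, $n\ge1$, of degree $1-n$; commutation with $D$ means that, with signs given by the Koszul rule, $$dX_{n+1}(a_0,\dots,a_n)=\sum_{0\le i<j\le n}\pm X_n([a_i,a_j],a_0,\dots,\widehat{a}_i,\dots,\widehat{a}_j,\dots,a_n)+\sum_{i=0}^n\pm[a_i,X_n(a_0,\dots,\widehat a_i,\dots,a_n)],$$ where $dX_{n+1}$ on the left denotes the differential of the map $X_{n+1}$ (its graded commutator with $d$), and $X_1$ commutes with $d$. Put $\mathscr X(\pi)=\sum_{n\ge1}\frac1{n!}X_n(\pi,\dots,\pi)$ and, for $a\in\mathfrak g$, $\mathscr X_\pi(a)=\sum_{n\ge1}\frac{1}{(n-1)!}X_n(a,\pi,\dots,\pi)$. *)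

(* Defs.v *)
From HB Require Import structures.
From mathcomp Require Import all_boot all_order all_algebra.
From mathcomp Require Import all_classical all_reals all_analysis.
From mathcomp Require Import complex.

Set Implicit Arguments.
Unset Strict Implicit.
Unset Printing Implicit Defensive.
Import Order.TTheory GRing.Theory Num.Theory.
Import numFieldNormedType.Exports.

Local Open Scope classical_set_scope.
Local Open Scope ring_scope.

Section Ck.
Context {R : realType} {n : nat}.
Implicit Types (V : set 'rV[R]_n) (g h : 'rV[R]_n -> R).

Definition basis_vec (i : 'I_n) : 'rV[R]_n := delta_mx 0 i.

Fixpoint Ck (k : nat) V g : Prop :=
  (forall x, V x -> {for x, continuous g}) /\
  (if k is k'.+1 then
     forall i, (forall x, V x -> derivable g x (basis_vec i)) /\
               Ck k' V ('D_(basis_vec i) g)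
   else True).

Definition smooth_on V g : Prop := forall k, Ck k V g.

Lemma Ck_pred k V g : Ck k.+1 V g -> Ck k V g.
Proof.
elim: k V g => [|k IH] V g [gc gd]; split=> // i.
by have [dg dgC] := gd i; split=> //; exact: IH.
Qed.

Lemma eq_Ck k V g h : open V -> (forall x, V x -> g x = h x) ->
  Ck k V g -> Ck k V h.
Proof.
have near_eq V' g' h' : open V' -> (forall x, V' x -> g' x = h' x) ->
    forall x, V' x -> \forall y \near x, g' y = h' y.
  move=> oV gh x Vx; have nV : nbhs x V' by exact: open_nbhs_nbhs.
  by apply: filterS nV => y; exact: gh.
have cont_eq V' g' h' : open V' -> (forall x, V' x -> g' x = h' x) ->
    (forall x, V' x -> {for x, continuous g'}) ->
    forall x, V' x -> {for x, continuous h'}.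
  move=> oV gh gc x Vx; rewrite /prop_for /continuous_at -(gh _ Vx).
  apply: cvg_trans (gc _ Vx).
  exact: (@near_eq_cvg _ _ (nbhs x) _ g' h' (near_eq _ _ _ oV gh x Vx)).
elim: k g h => [|k IH] g h oV gh [gc gd].
  by split=> //; exact: cont_eq gc.
split=> [|i]; first exact: cont_eq gc.
have [dg dgC] := gd i; split=> [x Vx|].
  by apply: near_eq_derivable (dg _ Vx); exact: near_eq gh x Vx.
by apply: IH dgC => // x Vx; apply: near_eq_derive; exact: near_eq gh x Vx.
Qed.

Lemma Ck_cst k V (c : R) : Ck k V (cst c).
Proof.
elim: k c => [|k IH] c; first by split=> // x _; exact: cst_continuous.
split; first by move=> x _; exact: cst_continuous.
move=> i; split=> [x _|]; first exact: derivable_cst.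
have -> : 'D_(basis_vec i) (cst c : 'rV[R]_n -> R) = cst 0.
  by apply/funext => x; rewrite derive_cst.
exact: IH.
Qed.

Lemma CkD k V g h : open V -> Ck k V g -> Ck k V h -> Ck k V (g + h).
Proof.
move=> oV; elim: k g h => [|k IH] g h [gc gd] [hc hd].
  split=> // x Vx; apply: continuousD; [exact: gc|exact: hc].
split; first by move=> x Vx; apply: continuousD; [exact: gc|exact: hc].
move=> i; have [dg dgC] := gd i; have [dh dhC] := hd i; split=> [x Vx|].
  by apply: derivableD; [exact: dg|exact: dh].
apply: (@eq_Ck _ _ ('D_(basis_vec i) g + 'D_(basis_vec i) h)) => //.
  by move=> x Vx; rewrite deriveD //; [exact: dg|exact: dh].
exact: IH.
Qed.

Lemma CkM k V g h : open V -> Ck k V g -> Ck k V h -> Ck k V (g * h).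
Proof.
move=> oV; elim: k g h => [|k IH] g h gC hC; have [gc gd] := gC; have [hc hd] := hC.
  by split=> // x Vx; apply: continuousM; [exact: gc|exact: hc].
split; first by move=> x Vx; apply: continuousM; [exact: gc|exact: hc].
move=> i; have [dg dgC] := gd i; have [dh dhC] := hd i; split=> [x Vx|].
  by apply: derivableM; [exact: dg|exact: dh].
apply: (@eq_Ck _ _ (g * 'D_(basis_vec i) h + h * 'D_(basis_vec i) g)) => //.
  by move=> x Vx; rewrite deriveM //; [exact: dg|exact: dh].
by apply: CkD => //; apply: IH => //; exact: Ck_pred.
Qed.

End Ck.

(* [phi] and [psi] are only meaningful on [dom] and [img] respectively. *)
Record chart (R : realType) (n : nat) (M : topologicalType) := Chart {
  dom : set M;
  img : set 'rV[R]_n;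
  phi : M -> 'rV[R]_n;
  psi : 'rV[R]_n -> M }.

Record is_chart (R : realType) (n : nat) (M : topologicalType)
    (c : chart R n M) : Prop := IsChart {
  dom_open : open (dom c);
  img_open : open (img c);
  phi_img : forall x, dom c x -> img c (phi c x);
  psi_dom : forall y, img c y -> dom c (psi c y);
  phiK : forall x, dom c x -> psi c (phi c x) = x;
  psiK : forall y, img c y -> phi c (psi c y) = y;
  phi_continuous : forall x, dom c x -> {for x, continuous (phi c)};
  psi_continuous : forall y, img c y -> {for y, continuous (psi c)} }.

Record manifold (R : realType) (n : nat) := Manifold {
  points :> topologicalType;
  atlas : set (chart R n points);
  points_hausdorff : hausdorff_space points;
  points_second_countable : @second_countable points;
  atlas_chart : forall c, atlas c -> is_chart c;
  atlas_cover : forall x, exists2 c, atlas c & dom c x;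
  atlas_smooth : forall c c', atlas c -> atlas c' -> forall j : 'I_n,
    smooth_on (img c `&` psi c @^-1` dom c')
              (fun y => phi c' (psi c y) ord0 j) }.

Inductive ground := RealField | ComplexField.

Definition scalar (R : realType) (k : ground) : fieldType :=
  match k with RealField => R | ComplexField => R[i] end.

Section Scalars.
Context {R : realType} {k : ground}.

Definition scalar_re : scalar R k -> R :=
  match k with RealField => id | ComplexField => @complex.Re R end.

Definition scalar_im : scalar R k -> R :=
  match k with RealField => fun=> 0 | ComplexField => @complex.Im R end.

Definition mk_scalar : R -> R -> scalar R k :=
  match k with RealField => fun x _ => x | ComplexField => @Complex R end.

Definition ksmooth_on n (V : set 'rV[R]_n) (g : 'rV[R]_n -> scalar R k) : Prop :=
  smooth_on V (scalar_re \o g) /\ smooth_on V (scalar_im \o g).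

Definition pderiv n (i : 'I_n) (g : 'rV[R]_n -> scalar R k) :
    'rV[R]_n -> scalar R k :=
  fun x => mk_scalar ('D_(basis_vec i) (scalar_re \o g) x)
                     ('D_(basis_vec i) (scalar_im \o g) x).

Definition pderivs n (w : seq 'I_n) (g : 'rV[R]_n -> scalar R k) :=
  foldr (@pderiv n) g w.

End Scalars.

Section KSmooth.
Context {R : realType} {n : nat}.
Implicit Types (V : set 'rV[R]_n).

Lemma ksmooth_cst k V (c : scalar R k) : ksmooth_on V (cst c).
Proof.
by split=> m; [exact: (Ck_cst m V (scalar_re c))|
               exact: (Ck_cst m V (scalar_im c))].
Qed.

Lemma ksmoothD k V (g h : 'rV[R]_n -> scalar R k) : open V ->
  ksmooth_on V g -> ksmooth_on V h -> ksmooth_on V (g + h).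
Proof.
case: k g h => g h oV [g1 g2] [h1 h2]; split=> m.
- by apply: eq_Ck (CkD oV (g1 m) (h1 m)).
- by apply: eq_Ck (Ck_cst _ _ 0).
- apply: eq_Ck (CkD oV (g1 m) (h1 m)) => // x _.
  by rewrite !fctE /=; case: (g x) (h x) => ? ? [].
- apply: eq_Ck (CkD oV (g2 m) (h2 m)) => // x _.
  by rewrite !fctE /=; case: (g x) (h x) => ? ? [].
Qed.

Lemma ksmoothM k V (g h : 'rV[R]_n -> scalar R k) : open V ->
  ksmooth_on V g -> ksmooth_on V h -> ksmooth_on V (g * h).
Proof.
case: k g h => g h oV [g1 g2] [h1 h2]; split=> m.
- by apply: eq_Ck (CkM oV (g1 m) (h1 m)).
- by apply: eq_Ck (Ck_cst _ _ 0).
- apply: eq_Ck (CkD oV (CkM oV (g1 m) (h1 m))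
    (CkM oV (Ck_cst m V (-1)) (CkM oV (g2 m) (h2 m)))) => // x _.
  by rewrite !fctE /=; case: (g x) (h x) => ? ? [? ?] /=; rewrite mulN1r.
- apply: eq_Ck (CkD oV (CkM oV (g1 m) (h2 m)) (CkM oV (g2 m) (h1 m))) => // x _.
  by rewrite !fctE /=; case: (g x) (h x) => ? ? [].
Qed.

End KSmooth.

Section SmoothFunctions.
Context {R : realType} {n : nat} (M : manifold R n) (k : ground).
Local Notation K := (scalar R k).

Definition is_smooth (f : M -> K^o) : Prop :=
  forall c, atlas c -> ksmooth_on (img c) (f \o psi c).

Definition smooth_pred : {pred M -> K^o} := [pred f | `[< is_smooth f >]].

Fact smooth_subring : subring_closed smooth_pred.
Proof.
have sM f g : f \in smooth_pred -> g \in smooth_pred -> f * g \in smooth_pred.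
  move=> /asboolP fs /asboolP gs; apply/asboolP => c ac.
  have oV := img_open (atlas_chart ac).
  exact: ksmoothM oV (fs c ac) (gs c ac).
have sD f g : f \in smooth_pred -> g \in smooth_pred -> f + g \in smooth_pred.
  move=> /asboolP fs /asboolP gs; apply/asboolP => c ac.
  have oV := img_open (atlas_chart ac).
  exact: ksmoothD oV (fs c ac) (gs c ac).
have sC (a : K^o) : cst a \in smooth_pred.
  by apply/asboolP => c ac; exact: ksmooth_cst.
split=> // [|f g fs gs]; first exact: sC.
by rewrite -mulN1r; apply: sD fs (sM _ _ _ gs); exact: (sC (-1)).
Qed.

HB.instance Definition _ := GRing.isSubringClosed.Build (M -> K^o) smooth_pred
  smooth_subring.

Fact smooth_scale : scaler_closed smooth_pred.
Proof.
move=> a f fs; have -> : a *: f = cst (a : K^o) * f by [].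
apply: rpredM => //; apply/asboolP => c ac.
exact: ksmooth_cst.
Qed.

HB.instance Definition _ := GRing.isScaleClosed.Build K (M -> K^o) smooth_pred
  smooth_scale.

Record smooth_fun := SmoothFun {
  smooth_val :> M -> K^o;
  smooth_valP : smooth_val \in smooth_pred }.

HB.instance Definition _ := [isSub for smooth_val].
HB.instance Definition _ := [Choice of smooth_fun by <:].
HB.instance Definition _ :=
  GRing.SubChoice_isSubComPzRing.Build _ _ smooth_fun (subringClosedP _).
HB.instance Definition _ :=
  [SubZmodule_isSubLmodule of smooth_fun by <:].

End SmoothFunctions.

(* Only the data: the carrier may be larger than the algebra itself, whose
   degree [k] part is [homog k]. *)
Record dgla (K : fieldType) := Dgla {
  carrier :> lmodType K;
  homog : int -> set carrier;
  dgd : carrier -> carrier;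
  dgbr : carrier -> carrier -> carrier }.

(* A cochain of arity [p] on an algebra [A] is a function on lists that vanishes
   on the lists of length other than [p] and is linear in each entry. *)

Section Cochains.
Context {K : fieldType} {A : lmodType K}.
Local Notation cochain := (seq A -> A).

Definition is_cochain (p : nat) (P : cochain) : Prop :=
  (forall s, size s <> p -> P s = 0) /\
  (forall s1 s2 (c : K) f g,
     P (s1 ++ (c *: f + g) :: s2) = c *: P (s1 ++ f :: s2) + P (s1 ++ g :: s2)).

(* Arity [p] sits in degree [p - 1]; nothing lives below degree -1. *)
Definition shifted (C : nat -> set cochain) (k : int) : set cochain :=
  match k + 1 with Posz p => C p | Negz _ => [set 0] end.

(* [P o Q - (-1)^((p-1)(q-1)) Q o P], extended bilinearly to sums of cochains of
   various arities.  [ins p q P Q] is [P o Q] for [P], [Q] of arity [p], [q].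
   The exponents below use [p.+1] for [p - 1]: only parities matter. *)
Definition insertion_bracket
    (ins : nat -> nat -> cochain -> cochain -> cochain) (P Q : cochain) : cochain :=
  fun s => \sum_(q < (size s).+2)
    (ins ((size s).+1 - q)%N q P Q s -
     (-1) ^+ (((size s).+1 - q).+1 * q.+1)%N *: ins q ((size s).+1 - q)%N Q P s).

Definition gerstenhaber_ins (p q : nat) (P Q : cochain) : cochain :=
  fun s => \sum_(i < p) (-1) ^+ (i * q.+1)%N *:
    P (take i s ++ Q (take q (drop i s)) :: drop (i + q) s).

(* The number of pairs of positions (i < j) with [i] unselected, [j] selected:
   the parity of the unshuffle moving the selected entries to the front. *)
Definition inversions (m : seq bool) : nat :=
  \sum_(j < size m | nth false m j) count negb (take j m).

Definition unshuffle_ins (p q : nat) (P Q : cochain) : cochain :=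
  fun s => \sum_(m : (size s).-tuple bool | count id m == q)
    (-1) ^+ inversions m *: P (Q (mask m s) :: mask (map negb m) s).

End Cochains.

Section Poly.
Context {R : realType} {n : nat} (M : manifold R n) (k : ground).
Local Notation K := (scalar R k).
Local Notation A := (smooth_fun M k).

(* Polyvector fields as skew-symmetric multiderivations of the functions. *)
Definition polyvector (p : nat) (P : seq A -> A) : Prop :=
  [/\ is_cochain p P,
      forall s1 s2 f g, P (s1 ++ f :: g :: s2) = - P (s1 ++ g :: f :: s2) &
      forall s1 s2 f g,
        P (s1 ++ (f * g) :: s2) = f * P (s1 ++ g :: s2) + g * P (s1 ++ f :: s2)].

(* Normalised by [X, f] = X f and [X, Y] = X Y - Y X for vector fields [X], [Y]
   and a function [f]; then [f, [pi, g]] = pi(f, g) for a bivector [pi]. *)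
Definition Tpoly : dgla K :=
  @Dgla K (seq A -> A) (shifted polyvector) (fun=> 0)
    (insertion_bracket unshuffle_ins).

(* A term (c, [:: w_1; ...; w_p]) stands for the operator
   (f_1, ..., f_p) |-> c * d_(w_1) f_1 * ... * d_(w_p) f_p. *)
Definition polydiff_term := (('rV[R]_n -> K) * seq (seq 'I_n))%type.

Definition eval_term (c : chart R n M) (t : polydiff_term) (s : seq A)
    (y : 'rV[R]_n) : K :=
  t.1 y * \prod_(wf <- zip t.2 s) pderivs wf.1 ((wf.2 : M -> K) \o psi c) y.

Definition polydifferential (p : nat) (P : seq A -> A) : Prop :=
  is_cochain p P /\
  forall c, atlas c -> forall x, img c x ->
  exists (V : set 'rV[R]_n) (ts : seq polydiff_term),
    [/\ open V, V x, V `<=` img c,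
        forall j, (j < size ts)%N ->
          ksmooth_on V (nth (0, [::]) ts j).1 /\
          size (nth (0, [::]) ts j).2 = p &
        forall s y, size s = p -> V y ->
          P s (psi c y) = \sum_(t <- ts) eval_term c t s y].

Definition mul_cochain : seq A -> A :=
  fun s => if s is [:: f; g] then f * g else 0.

(* The Hochschild differential is the bracket with the product, so that the
   Maurer-Cartan equation for [pi] is the associativity of [mul_cochain + pi]. *)
Definition Dpoly : dgla K :=
  @Dgla K (seq A -> A) (shifted polydifferential)
    (insertion_bracket gerstenhaber_ins mul_cochain)
    (insertion_bracket gerstenhaber_ins).

End Poly.

(* g[[hbar]]: [u i] is the coefficient of hbar^i. *)
Definition formal (K : fieldType) (L : dgla K) : dgla K :=
  @Dgla K (nat -> L)
    (fun k => [set u | forall i, homog k (u i)])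
    (fun u i => dgd (u i))
    (fun u v i => \sum_(j < i.+1) dgbr (u j) (v (i - j)%N)).

Inductive poly_kind := Polyvectors | PolydiffOperators.
Inductive coefficients := Plain | FormalSeries.

Definition poly_dgla (R : realType) (n : nat) (M : manifold R n) (k : ground)
    (kind : poly_kind) (co : coefficients) : dgla (scalar R k) :=
  let L := match kind with
           | Polyvectors => Tpoly M k
           | PolydiffOperators => Dpoly M k
           end in
  match co with Plain => L | FormalSeries => formal L end.

Section Twist.
Context {K : fieldType} {L : dgla K}.

Definition maurer_cartan (pi : L) : Prop :=
  homog 1 pi /\ dgd pi + 2%:R^-1 *: dgbr pi pi = 0.

Definition twisted_diff (pi a : L) : L := dgd a + dgbr pi a.

Definition derived_bracket (pi f g : L) : L := dgbr f (dgbr pi g).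

End Twist.

(* A separated topology on each degree, given by the neighbourhoods of 0,
   compatible with the linear structure, the differential and the bracket with
   a fixed element. *)
Record graded_topology (K : fieldType) (L : dgla K) := GradedTopology {
  nbhs0 : int -> set_system L;
  nbhs0_filter : forall k, Filter (nbhs0 k);
  nbhs0_mem : forall k U, nbhs0 k U -> U 0;
  nbhs0_sep : forall k x, homog k x -> (forall U, nbhs0 k U -> U x) -> x = 0;
  nbhs0_sub : forall k U, nbhs0 k U -> exists2 V, nbhs0 k V &
    forall x y, homog k x -> homog k y -> V x -> V y -> U (x - y);
  nbhs0_scale : forall k (c : K) U, nbhs0 k U -> exists2 V, nbhs0 k V &
    forall x, homog k x -> V x -> U (c *: x);
  nbhs0_dgd : forall k U, nbhs0 (k + 1) U -> exists2 V, nbhs0 k V &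
    forall x, homog k x -> V x -> U (dgd x);
  nbhs0_dgbr : forall j k a U, homog j a -> nbhs0 (j + k) U ->
    exists2 V, nbhs0 k V & forall x, homog k x -> V x -> U (dgbr a x) }.

Section Limits.
Context {K : fieldType} {L : dgla K} (tau : graded_topology L).

Definition gcvg (k : int) (u : nat -> L) (l : L) : Prop :=
  homog k l /\ forall U, nbhs0 tau k U -> \forall N \near \oo, U (u N - l).

Definition glim (k : int) (u : nat -> L) : L := xget 0 [set l | gcvg k u l].

End Limits.

(* A word [:: (k_1, a_1); ...; (k_n, a_n)] records elements together with their
   degrees in [L]; the Koszul signs are those of L[1], where [a_i] has degree
   [k_i - 1]. *)

Section Linf.
Context {K : fieldType} {L : dgla K}.
Local Notation word := (seq (int * L)).
Implicit Types (w : word) (X : seq L -> L).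

Definition homog_word w : Prop := forall x, x \in w -> homog x.1 x.2.

(* The degree of X_n (a_1, ..., a_n). *)
Definition word_degree w : int := \sum_(x <- w) x.1 + 1 - (size w)%:Z.

Definition letter w (i : nat) : int * L := nth (0, 0) w i.

(* The degree in L[1], as a natural number: only its parity matters. *)
Definition sdeg (x : int * L) : nat := `|x.1 - 1|%N.

Definition remove T (i : nat) (s : seq T) : seq T := take i s ++ drop i.+1 s.

(* Sign for moving the [i]-th letter to the front, and, for [i < j], the [i]-th
   and [j]-th letters to the first two positions. *)
Definition koszul1 w (i : nat) : K :=
  (-1) ^+ (sdeg (letter w i) * \sum_(l < i) sdeg (letter w l))%N.

Definition koszul2 w (i j : nat) : K :=
  koszul1 w i *
  (-1) ^+ (sdeg (letter w j) *
           \sum_(l < j | nat_of_ord l != i) sdeg (letter w l))%N.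

(* The second Taylor coefficient of the codifferential, on L[1]; the first one
   is [dgd].  With this sign D(e^pi) = 0 is the Maurer-Cartan equation. *)
Definition codiff2 (x : int * L) (b : L) : L := (-1) ^+ sdeg x *: dgbr x.2 b.

(* [X] gathers the Taylor coefficients of a coderivation of degree 0 of the free
   coalgebra on L[1]: X_n is the restriction of [X] to lists of length [n], and
   there is no X_0.  [linf_comm] is the component in L of [D, X] = 0. *)
Record linf_derivation X : Prop := LinfDerivation {
  linf_nil : X [::] = 0;
  linf_degree : forall w, homog_word w -> homog (word_degree w) (X (unzip2 w));
  linf_linear : forall w1 w2 k a b (c : K),
    homog_word w1 -> homog_word w2 -> homog k a -> homog k b ->
    X (unzip2 w1 ++ (c *: a + b) :: unzip2 w2) =
    c *: X (unzip2 w1 ++ a :: unzip2 w2) + X (unzip2 w1 ++ b :: unzip2 w2);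
  linf_sym : forall w1 w2 x y,
    homog_word w1 -> homog_word w2 -> homog x.1 x.2 -> homog y.1 y.2 ->
    X (unzip2 w1 ++ x.2 :: y.2 :: unzip2 w2) =
    (-1) ^+ (sdeg x * sdeg y)%N *: X (unzip2 w1 ++ y.2 :: x.2 :: unzip2 w2);
  linf_comm : forall w, homog_word w ->
    dgd (X (unzip2 w)) +
    \sum_(i < size w) koszul1 w i *:
      codiff2 (letter w i) (X (unzip2 (remove i w))) =
    \sum_(i < size w) koszul1 w i *:
      X (dgd (letter w i).2 :: unzip2 (remove i w)) +
    \sum_(j < size w) \sum_(i < j) koszul2 w i j *:
      X (codiff2 (letter w i) (letter w j).2 ::
         unzip2 (remove i (remove j w))) }.

(* The series  sum_m X_(r+m) (a_1, ..., a_r, pi, ..., pi) / m!  : it is X(pi) for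
   the empty word and X_pi(a) for the word [:: (k, a)]. *)
Definition twist_series X (pi : L) w (N : nat) : L :=
  \sum_(m < N) (m`!%:R)^-1 *: X (unzip2 w ++ nseq m pi).

Variable tau : graded_topology L.

Definition twist X (pi : L) w : L :=
  glim tau (word_degree w) (twist_series X pi w).

Definition apply_mc X (pi : L) : L := twist X pi [::].

Definition tangent X (pi : L) (k : int) (a : L) : L := twist X pi [:: (k, a)].

Definition series_converge X (pi : L) : Prop :=
  forall w, homog_word w ->
  exists l, gcvg tau (word_degree w) (twist_series X pi w) l.

(* X(pi) has degree 1. *)
Definition weak_nijenhuis X (pi : L) : Prop :=
  tangent X pi 1 (apply_mc X pi) = 0.

End Linf.

(* Main.v *)
Require Import Defs.
From mathcomp Require Import all_boot all_order all_algebra.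
From mathcomp Require Import all_classical all_reals all_analysis.
From mathcomp Require Import complex.
From mathcomp Require Import ring zify.

(** Write Phi(w) for the sum of the series of X_(r+m)(w, pi, ..., pi) / m!, where
    w is a word of length r.  Because [pi] is a Maurer-Cartan element, these maps
    are again the Taylor coefficients of a derivation commuting with the
    codifferential, now for the differential d_pi and with the constant term
    xi = Phi() = X(pi); this is [twisted_comm].  For functions f, g with
    d_pi f = d_pi g = 0 put F = Phi(f), G = Phi(g) and eta = [xi, f].  In the
    words below nearly every term vanishes, either because a letter is closed or
    because nothing lives below degree -1, and what remains is
    - for the empty word: d_pi xi = 0;
    - for f: [pi, F] = - eta ([br_tangent]);
    - for (f, xi), where the Nijenhuis condition Phi(xi) = 0 enters:
      [pi, Phi(f, xi)] + [xi, F] = Phi(eta) ([br_xi_tangent]);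
    - for (g, eta): [g, Phi(eta)] = [eta, G] ([br_fun_twist_eta]).

    For p of degree 1 the form (a, b) |-> [a, [p, b]] on functions is
    antisymmetric, and for p = pi it has g in its kernel.  Therefore
      [F, [pi, G]] = - [F, [xi, g]] = [g, [xi, F]] = [g, Phi(eta)]
                   = [eta, G] = [G, [pi, F]] = - [F, [pi, G]],
    and the bracket vanishes in characteristic 0.

    The argument stays in degrees -1, ..., 2, and the properties of the
    differential and of the bracket that it needs are collected in [lower_dgla].
    They hold for polyvector fields by explicit formulas in low arity
    ([lower_Tpoly]), for polydifferential operators because these are stable
    under composition ([lower_Dpoly]), and they pass to formal power series
    ([lower_formal]). *)

Set Implicit Arguments.
Unset Strict Implicit.
Unset Printing Implicit Defensive.
Import Order.TTheory GRing.Theory Num.Theory.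
Import numFieldNormedType.Exports.
Local Open Scope classical_set_scope.
Local Open Scope ring_scope.

(** * Lie algebras in degrees -1 to 2 *)

(** The brackets listed as homogeneous are those of degrees (1, 1), (1, -1) and
    (0, -1).  The Jacobi identity occurs in two cases: on a function, an element
    of degree 1 and a function, where it reads as the antisymmetry of the derived
    bracket, and on two elements of degree 1 and a function. *)
Record lower_dgla (K : fieldType) (L : dgla K) : Prop := LowerDgla {
  homog0 : forall k, homog k (0 : L);
  homogL : forall k (c : K) (a b : L),
    homog k a -> homog k b -> homog k (c *: a + b);
  homog_low : forall k (a : L), k < -1 -> homog k a -> a = 0;
  dgdL : forall (c : K) (a b : L), dgd (c *: a + b) = c *: dgd a + dgd b;
  homog_d : forall k (a : L), homog k a -> homog (k + 1) (dgd a);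
  d_fun : forall a : L, homog (-1) a -> dgd a = 0;
  dgbrL : forall k (c : K) (a b b' : L), homog k a ->
    dgbr a (c *: b + b') = c *: dgbr a b + dgbr a b';
  dgbr_anti : forall j k (a b : L), homog j a -> homog k b ->
    dgbr a b = - (-1) ^+ (`|j| * `|k|)%N *: dgbr b a;
  homog_br11 : forall a b : L, homog 1 a -> homog 1 b -> homog 2 (dgbr a b);
  homog_br1N : forall a b : L, homog 1 a -> homog (-1) b -> homog 0 (dgbr a b);
  homog_br0N : forall a b : L, homog 0 a -> homog (-1) b -> homog (-1) (dgbr a b);
  derived_anti : forall p a b : L, homog 1 p -> homog (-1) a -> homog (-1) b ->
    dgbr a (dgbr p b) = - dgbr b (dgbr p a);
  jacobi11N : forall p q a : L, homog 1 p -> homog 1 q -> homog (-1) a ->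
    dgbr p (dgbr q a) + dgbr q (dgbr p a) = dgbr (dgbr p q) a;
  d_br1N : forall p a : L, homog 1 p -> homog (-1) a ->
    dgd (dgbr p a) = dgbr (dgd p) a }.

Section LowerTheory.
Context {K : fieldType} {L : dgla K} (LL : lower_dgla L).
Implicit Types a b : L.

Lemma homogD k a b : homog k a -> homog k b -> homog k (a + b).
Proof. by move=> ha hb; rewrite -[a]scale1r; exact: (homogL LL). Qed.

Lemma homogZ k (c : K) a : homog k a -> homog k (c *: a).
Proof.
by move=> ha; rewrite -[_ *: a]addr0; apply: (homogL LL) => //; exact: (homog0 LL).
Qed.

Lemma homogB k a b : homog k a -> homog k b -> homog k (a - b).
Proof. by move=> ha hb; rewrite -scaleN1r addrC; exact: (homogL LL). Qed.

Lemma homog_sum k (I : Type) (r : seq I) (P : pred I) (F : I -> L) :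
  (forall i, P i -> homog k (F i)) -> homog k (\sum_(i <- r | P i) F i).
Proof.
by move=> hF; elim/big_ind: _ => //; [exact: (homog0 LL)|exact: homogD].
Qed.

Lemma dgd0 : dgd (0 : L) = 0.
Proof.
by have := dgdL LL 1 0 0; rewrite !scale1r addr0 -[X in X = _]addr0 => /addrI.
Qed.

Lemma dgdD a b : dgd (a + b) = dgd a + dgd b.
Proof. by have := dgdL LL 1 a b; rewrite !scale1r. Qed.

Lemma dgdZ (c : K) a : dgd (c *: a) = c *: dgd a.
Proof. by have := dgdL LL c a 0; rewrite !addr0 dgd0 addr0. Qed.

Lemma dgdN a : dgd (- a) = - dgd a.
Proof. by rewrite -scaleN1r dgdZ scaleN1r. Qed.

Lemma dgd_sum (I : Type) (r : seq I) (P : pred I) (F : I -> L) :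
  dgd (\sum_(i <- r | P i) F i) = \sum_(i <- r | P i) dgd (F i).
Proof. by apply: (big_morph _ dgdD dgd0). Qed.

Section Right.
Variables (k : int) (x : L).
Hypothesis hx : homog k x.

Lemma dgbrr0 : dgbr x 0 = 0.
Proof.
by have := dgbrL LL 1 0 0 hx; rewrite !scale1r addr0 -[X in X = _]addr0 => /addrI.
Qed.

Lemma dgbrrD a b : dgbr x (a + b) = dgbr x a + dgbr x b.
Proof. by have := dgbrL LL 1 a b hx; rewrite !scale1r. Qed.

Lemma dgbrrZ (c : K) a : dgbr x (c *: a) = c *: dgbr x a.
Proof. by have := dgbrL LL c a 0 hx; rewrite !addr0 dgbrr0 addr0. Qed.

Lemma dgbrrN a : dgbr x (- a) = - dgbr x a.
Proof. by rewrite -scaleN1r dgbrrZ scaleN1r. Qed.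

Lemma dgbrrB a b : dgbr x (a - b) = dgbr x a - dgbr x b.
Proof. by rewrite dgbrrD dgbrrN. Qed.

Lemma dgbrr_sum (I : Type) (r : seq I) (P : pred I) (F : I -> L) :
  dgbr x (\sum_(i <- r | P i) F i) = \sum_(i <- r | P i) dgbr x (F i).
Proof. by apply: (big_morph _ dgbrrD dgbrr0). Qed.

Lemma dgbrlD j a b : homog j a -> homog j b -> dgbr (a + b) x = dgbr a x + dgbr b x.
Proof.
move=> ha hb; rewrite (dgbr_anti LL (homogD ha hb) hx) (dgbr_anti LL ha hx).
by rewrite (dgbr_anti LL hb hx) dgbrrD scalerDr.
Qed.

Lemma dgbrlZ j (c : K) a : homog j a -> dgbr (c *: a) x = c *: dgbr a x.
Proof.
move=> ha; rewrite (dgbr_anti LL (homogZ c ha) hx) (dgbr_anti LL ha hx).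
by rewrite dgbrrZ !scalerA mulrC.
Qed.

Lemma dgbrl0 : dgbr 0 x = 0.
Proof. by have := dgbrlZ 0 (homog0 LL 0); rewrite !scale0r. Qed.

Lemma dgbrl_sum j (I : Type) (r : seq I) (P : pred I) (F : I -> L) :
  (forall i, P i -> homog j (F i)) ->
  dgbr (\sum_(i <- r | P i) F i) x = \sum_(i <- r | P i) dgbr (F i) x.
Proof.
move=> hF; elim: r => [|i r IH]; first by rewrite !big_nil dgbrl0.
rewrite !big_cons; case: ifP => // Pi.
by rewrite (dgbrlD (j := j)) ?IH //; [exact: hF|exact: homog_sum].
Qed.

End Right.

Lemma dgbr_sym1N a b : homog 1 a -> homog (-1) b -> dgbr b a = dgbr a b.
Proof. by move=> ha hb; rewrite (dgbr_anti LL hb ha) expr1 opprK scale1r. Qed.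

Lemma dgbr_anti0N a b : homog 0 a -> homog (-1) b -> dgbr b a = - dgbr a b.
Proof. by move=> ha hb; rewrite (dgbr_anti LL hb ha) scaleN1r. Qed.

End LowerTheory.

(** * Words padded with a Maurer-Cartan element *)

Section Words.
Context {K : fieldType} {L : dgla K}.
Local Notation word := (seq (int * L)).
Implicit Types w : word.

Lemma homog_letter w i : homog_word w -> (i < size w)%N ->
  homog (letter w i).1 (letter w i).2.
Proof. by move=> hw iw; apply: hw; exact: mem_nth. Qed.

Lemma homog_remove w i : homog_word w -> homog_word (remove i w).
Proof. by move=> hw x; rewrite mem_cat => /orP[/mem_take|/mem_drop]; exact: hw. Qed.

Lemma homog_nil : homog_word ([::] : word).
Proof. by []. Qed.

Lemma homog_cons w k (a : L) : homog k a -> homog_word w -> homog_word ((k, a) :: w).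
Proof. by move=> ha hw x; rewrite inE => /orP[/eqP-> //|]; exact: hw. Qed.

Lemma homog_cat w w' : homog_word w -> homog_word w' -> homog_word (w ++ w').
Proof. by move=> hw hw' x; rewrite mem_cat => /orP[/hw|/hw']. Qed.

Lemma homog_nseq m k (a : L) : homog k a -> homog_word (nseq m (k, a)).
Proof. by move=> ha x; rewrite mem_nseq => /andP[_ /eqP->]. Qed.

Lemma word_degree_nil : word_degree ([::] : word) = 1.
Proof. by rewrite /word_degree big_nil. Qed.

Lemma word_degree_cons w (x : int * L) :
  word_degree (x :: w) = x.1 + word_degree w - 1.
Proof. by rewrite /word_degree big_cons /= intS; ring. Qed.

(** The degree of a word counts each letter in L[1], up to a global shift by 1. *)
Lemma word_degree_remove w i : (i < size w)%N ->
  word_degree (remove i w) = word_degree w - (letter w i).1 + 1.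
Proof.
move=> iw; have wE : w = take i w ++ letter w i :: drop i.+1 w.
  by rewrite -drop_nth // cat_take_drop.
rewrite {2}wE /word_degree !big_cat big_cons !size_cat /= addnS intS; ring.
Qed.

Lemma letter_remove w i j : (i < j)%N -> letter (remove j w) i = letter w i.
Proof.
move=> ij; rewrite /letter /remove nth_cat size_take.
case: (ltnP j (size w)) => jw; first by rewrite ij nth_take.
case: ifP => [iw|/negbT]; first by rewrite nth_take.
by rewrite -leqNgt => iw; rewrite !nth_default // size_drop; lia.
Qed.

Lemma letter_cat w w' i : (i < size w)%N -> letter (w ++ w') i = letter w i.
Proof. by move=> iw; rewrite /letter nth_cat iw. Qed.

Lemma letter_pad w m x i : (i < m)%N -> letter (w ++ nseq m x) (size w + i) = x.
Proof.
by move=> im; rewrite /letter nth_cat ltnNge leq_addr /= addKn nth_nseq im.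
Qed.

Lemma remove_cat w w' i : (i < size w)%N -> remove i (w ++ w') = remove i w ++ w'.
Proof.
move=> iw; rewrite /remove take_cat iw drop_cat -catA.
case: ltnP => // iw'; have -> : i.+1 = size w by apply/eqP; rewrite eqn_leq iw.
by rewrite subnn drop0 drop_size.
Qed.

Lemma remove_pad w m x i : (i < m)%N ->
  remove (size w + i) (w ++ nseq m x) = w ++ nseq m.-1 x.
Proof.
move=> im; rewrite /remove take_cat ltnNge leq_addr /= addKn.
rewrite -addnS drop_cat ltnNge leq_addr /= addKn -catA; congr (_ ++ _).
rewrite take_nseq ?(ltnW im) // drop_nseq -nseqD; congr nseq; lia.
Qed.

Lemma koszul1_cat w w' i : (i < size w)%N -> koszul1 (w ++ w') i = koszul1 w i.
Proof.
move=> iw; rewrite /koszul1 letter_cat //; congr (_ ^+ (_ * _)%N).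
by apply: eq_bigr => l _; rewrite letter_cat // (ltn_trans _ iw).
Qed.

Lemma koszul2_cat w w' i j : (i < size w)%N -> (j < size w)%N ->
  koszul2 (w ++ w') i j = koszul2 w i j.
Proof.
move=> iw jw; rewrite /koszul2 koszul1_cat // letter_cat //.
congr (_ * _ ^+ (_ * _)%N).
by apply: eq_bigr => l _; rewrite letter_cat // (ltn_trans _ jw).
Qed.

(** Letters of degree 1 are even in L[1], so that moving them costs no sign. *)
Lemma koszul1_pad w m (a : L) i : (i < m)%N ->
  koszul1 (w ++ nseq m (1, a)) (size w + i) = 1.
Proof. by move=> im; rewrite /koszul1 letter_pad. Qed.

Lemma koszul2_pad w m (a : L) i j : (j < m)%N ->
  koszul2 (w ++ nseq m (1, a)) i (size w + j) = koszul1 (w ++ nseq m (1, a)) i.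
Proof. by move=> jm; rewrite /koszul2 letter_pad // mul0n expr0 mulr1. Qed.

Lemma sum_pad (V : zmodType) w m x (F : nat -> V) :
  \sum_(i < size (w ++ nseq m x)) F i =
  \sum_(i < size w) F i + \sum_(i < m) F (size w + i)%N.
Proof.
by rewrite size_cat size_nseq big_split_ord.
Qed.

End Words.

Arguments homog_nil {K L}.

(** * Summation of the commutation relation *)

Section ExponentialSeries.
Context {K : fieldType} {V : lmodType K}.
Hypothesis char0 : forall m, m.+1%:R != 0 :> K.
Implicit Types G : nat -> V.

(** Of m identical letters any one can be selected, and m / m! = 1 / (m - 1)!. *)
Lemma exp_series_shift1 G N :
  \sum_(m < N.+1) (m`!%:R : K)^-1 *: (G m.-1 *+ m) =
  \sum_(m < N) (m`!%:R : K)^-1 *: G m.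
Proof.
rewrite big_ord_recl /= mulr0n scaler0 add0r; apply: eq_bigr => m _.
rewrite /bump leq0n add1n /= -scaler_nat scalerA factS natrM invfM.
by rewrite mulrAC mulVf ?char0 // mul1r.
Qed.

(** Of m identical letters any two can be selected, and
    C(m, 2) / m! = 1 / (2 (m - 2)!). *)
Lemma exp_series_shift2 G N :
  \sum_(m < N.+2) (m`!%:R : K)^-1 *: (G m.-2 *+ 'C(m, 2)) =
  2%:R^-1 *: \sum_(m < N) (m`!%:R : K)^-1 *: G m.
Proof.
rewrite 2!big_ord_recl /= !mulr0n !scaler0 !add0r scaler_sumr.
apply: eq_bigr => m _.
rewrite /bump !leq0n !add1n /= -scaler_nat !scalerA; congr (_ *: _).
have nz : (m.+2)`!%:R != 0 :> K by rewrite -(prednK (fact_gt0 _)) char0.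
have nzm : m`!%:R != 0 :> K by rewrite -(prednK (fact_gt0 _)) char0.
have := @bin_fact m.+2 2 isT; rewrite subSS subSS subn0 => E.
apply: (mulfI nz); rewrite mulVKf // -E !natrM.
by field; rewrite nzm (char0 1).
Qed.

End ExponentialSeries.

Section FiniteIdentity.
Context {K : fieldType} {L : dgla K} (LL : lower_dgla L).
Local Notation word := (seq (int * L)).
Variables (pi : L) (X : seq L -> L).
Hypotheses (hpi : homog 1 pi) (hX : linf_derivation X).
Implicit Types w : word.

(** In L[1] the second coefficient of the codifferential is graded symmetric,
    so that inserting [pi] on the right amounts to bracketing with it on the left. *)
Lemma codiff2_pi k (a : L) : homog k a -> codiff2 (k, a) pi = dgbr pi a.
Proof.
move=> ha; rewrite /codiff2 /sdeg /= (dgbr_anti LL ha hpi) scalerA muln1.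
have -> : (-1) ^+ `|k - 1| = - (-1) ^+ `|k| :> K; last by rewrite mulrNN -expr2 sqrr_sign scale1r.
have [->|->] : `|k - 1|%N = `|k|.+1 \/ `|k|%N = `|k - 1|.+1 by lia.
  by rewrite exprS mulN1r.
by rewrite exprS mulN1r opprK.
Qed.

Lemma unzip2_pad w m : unzip2 (w ++ nseq m (1%:Z, pi)) = unzip2 w ++ nseq m pi.
Proof. by rewrite /unzip2 map_cat map_nseq. Qed.

Lemma sum_nat_bin (V : zmodType) (c : V) m : \sum_(j < m) c *+ j = c *+ 'C(m, 2).
Proof. by rewrite -bin2_sum big_mkord -sumrMnr. Qed.

(** The relation [D, X] = 0 on w, pi, ..., pi, with the letters taken from w
    separated from the copies of [pi]. *)
Lemma linf_comm_pad w m : homog_word w ->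
  dgd (X (unzip2 w ++ nseq m pi)) +
  \sum_(i < size w) koszul1 w i *:
     codiff2 (letter w i) (X (unzip2 (remove i w) ++ nseq m pi)) +
  dgbr pi (X (unzip2 w ++ nseq m.-1 pi)) *+ m =
  \sum_(i < size w) koszul1 w i *:
     X (dgd (letter w i).2 :: unzip2 (remove i w) ++ nseq m pi) +
  X (dgd pi :: unzip2 w ++ nseq m.-1 pi) *+ m +
  (\sum_(j < size w) \sum_(i < j) koszul2 w i j *:
     X (codiff2 (letter w i) (letter w j).2 ::
        unzip2 (remove i (remove j w)) ++ nseq m pi) +
   (\sum_(i < size w) koszul1 w i *:
     X (dgbr pi (letter w i).2 :: unzip2 (remove i w) ++ nseq m.-1 pi)) *+ m +
   X (dgbr pi pi :: unzip2 w ++ nseq m.-2 pi) *+ 'C(m, 2)).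
Proof.
move=> hw.
have hwm : homog_word (w ++ nseq m (1, pi)).
  by apply: homog_cat => //; exact: homog_nseq.
have := linf_comm hX hwm.
pose W := w ++ nseq m (1%:Z, pi).
rewrite (sum_pad _ _ _ (fun i => koszul1 W i *: codiff2 (letter W i) (X (unzip2 (remove i W))))).
rewrite (sum_pad _ _ _ (fun i => koszul1 W i *: X (dgd (letter W i).2 :: unzip2 (remove i W)))).
rewrite (sum_pad _ _ _ (fun j => \sum_(i < j) koszul2 W i j *:
  X (codiff2 (letter W i) (letter W j).2 :: unzip2 (remove i (remove j W))))).
rewrite /W unzip2_pad.
under eq_bigr => i _ do
  rewrite koszul1_cat // letter_cat // remove_cat // unzip2_pad.
under [X in _ + (_ + X) = _ -> _]eq_bigr => i _ do
  rewrite koszul1_pad // letter_pad // remove_pad // unzip2_pad scale1r /codiff2 expr0 scale1r.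
under [X in _ = X + _ + _ -> _]eq_bigr => i _ do
  rewrite koszul1_cat // letter_cat // remove_cat // unzip2_pad.
under [X in _ = _ + X + _ -> _]eq_bigr => i _ do
  rewrite koszul1_pad // letter_pad // remove_pad // unzip2_pad scale1r.
rewrite !sumr_const !card_ord addrA => ->; congr (_ + _).
rewrite -addrA; congr (_ + _).
  apply: eq_bigr => j _; apply: eq_bigr => i _.
  have iw : (i < size w)%N by exact: ltn_trans (ltn_ord j).
  have ijw : (i < size (remove j w))%N.
    by rewrite size_cat size_take ltn_ord (leq_trans (ltn_ord i)) ?leq_addr.
  by rewrite koszul2_cat // !letter_cat // remove_cat // remove_cat // unzip2_pad.
(* Pairs whose second letter is a copy of pi: the first one is either a letter
   of w or an earlier copy. *)
under eq_bigr => j _.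
  rewrite big_split_ord /=.
  under eq_bigr => i _ do rewrite koszul2_pad // koszul1_cat // letter_cat //
    letter_pad // remove_pad // remove_cat // unzip2_pad
    (surjective_pairing (letter w i))
    (codiff2_pi (homog_letter hw (ltn_ord i))) /=.
  under [X in _ + X]eq_bigr => i _.
    have im : (i < m)%N := ltn_trans (ltn_ord i) (ltn_ord j).
    have im1 : (i < m.-1)%N by have := ltn_ord i; have := ltn_ord j; lia.
    rewrite koszul2_pad // koszul1_pad // !letter_pad // !remove_pad //.
    rewrite unzip2_pad scale1r codiff2_pi //.
    over.
  rewrite sumr_const card_ord.
  over.
by rewrite /= big_split /= sumr_const card_ord sum_nat_bin.
Qed.
End FiniteIdentity.

Lemma scale_exchange (K : fieldType) (V : lmodType K) N n (e : nat -> K)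
    (c : nat -> K) (F : nat -> nat -> V) :
  \sum_(m < N) e m *: \sum_(i < n) c i *: F i m =
  \sum_(i < n) c i *: \sum_(m < N) e m *: F i m.
Proof.
under eq_bigr => m _ do rewrite scaler_sumr.
rewrite exchange_big /=; apply: eq_bigr => i _; rewrite scaler_sumr.
by apply: eq_bigr => m _; rewrite !scalerA mulrC.
Qed.

Section SeriesIdentity.
Context {K : fieldType} {L : dgla K} (LL : lower_dgla L).
Hypothesis char0 : forall m, m.+1%:R != 0 :> K.
Local Notation word := (seq (int * L)).
Variables (pi : L) (X : seq L -> L).
Hypotheses (hpi : homog 1 pi) (hX : linf_derivation X).
Implicit Types w : word.
Local Notation S := (twist_series X pi).

Lemma dgd_twist_series w N :
  dgd (S w N) = \sum_(m < N) (m`!%:R)^-1 *: dgd (X (unzip2 w ++ nseq m pi)).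
Proof. by rewrite (dgd_sum LL); apply: eq_bigr => m _; rewrite (dgdZ LL). Qed.

Lemma dgbr_twist_series k (a : L) w N : homog k a ->
  dgbr a (S w N) = \sum_(m < N) (m`!%:R)^-1 *: dgbr a (X (unzip2 w ++ nseq m pi)).
Proof.
by move=> ha; rewrite (dgbrr_sum LL ha); apply: eq_bigr => m _; rewrite (dgbrrZ LL ha).
Qed.

Lemma codiff2_twist_series x w N : homog x.1 x.2 ->
  codiff2 x (S w N) =
  \sum_(m < N) (m`!%:R)^-1 *: codiff2 x (X (unzip2 w ++ nseq m pi)).
Proof.
move=> hx; rewrite /codiff2 (dgbr_twist_series _ _ hx) scaler_sumr.
by apply: eq_bigr => m _; rewrite !scalerA mulrC.
Qed.

(** The previous relation divided by m! and summed over m; each selected copy of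
    [pi] shortens the partial sum by one term. *)
Lemma twist_series_comm w N : homog_word w ->
  dgd (S w N.+2) +
  \sum_(i < size w) koszul1 w i *: codiff2 (letter w i) (S (remove i w) N.+2) +
  dgbr pi (S w N.+1) =
  \sum_(i < size w) koszul1 w i *:
    S (((letter w i).1 + 1, dgd (letter w i).2) :: remove i w) N.+2 +
  S ((2, dgd pi) :: w) N.+1 +
  (\sum_(j < size w) \sum_(i < j) koszul2 w i j *:
     S (((letter w i).1 + (letter w j).1, codiff2 (letter w i) (letter w j).2) ::
        remove i (remove j w)) N.+2 +
   \sum_(i < size w) koszul1 w i *:
     S (((letter w i).1 + 1, dgbr pi (letter w i).2) :: remove i w) N.+1 +
   2%:R^-1 *: S ((2, dgbr pi pi) :: w) N).
Proof.
move=> hw; pose e m : K := (m`!%:R)^-1.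
have := @eq_bigr L 0 +%R 'I_N.+2 (index_enum _) xpredT _ _ (fun m _ =>
  congr1 (fun x : L => e m *: x) (linf_comm_pad LL hpi hX m hw)).
rewrite /=.
under eq_bigr => m _ do rewrite !scalerDr.
under [in X in _ = X -> _]eq_bigr => m _ do rewrite !scalerDr.
rewrite !big_split /=.
have E (F : nat -> L) : \sum_(m < N.+2) e m *: (F m.-1 *+ m) = \sum_(m < N.+1) e m *: F m.
  exact: exp_series_shift1.
rewrite !(E (fun m => dgbr pi (X (unzip2 w ++ nseq m pi)))).
rewrite (E (fun m => X (dgd pi :: unzip2 w ++ nseq m pi))).
rewrite (E (fun m => \sum_(i < size w) koszul1 w i *:
     X (dgbr pi (letter w i).2 :: unzip2 (remove i w) ++ nseq m pi))).
rewrite (exp_series_shift2 char0 (fun m => X (dgbr pi pi :: unzip2 w ++ nseq m pi))).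
rewrite (scale_exchange _ _ _ (koszul1 w) (fun i m => codiff2 (letter w i) (X (unzip2 (remove i w) ++ nseq m pi)))).
rewrite (scale_exchange _ _ _ (koszul1 w) (fun i m => X (dgd (letter w i).2 :: unzip2 (remove i w) ++ nseq m pi))).
rewrite (scale_exchange _ _ _ (koszul1 w) (fun i m => X (dgbr pi (letter w i).2 :: unzip2 (remove i w) ++ nseq m pi))).
rewrite dgd_twist_series (dgbr_twist_series _ _ hpi).
under [in X in _ -> X]eq_bigr => i _ do
  rewrite (codiff2_twist_series _ _ (homog_letter hw (ltn_ord i))).
move=> ->; congr (_ + (_ + _ + _)).
under eq_bigr => m _ do rewrite scaler_sumr.
rewrite exchange_big /=; apply: eq_bigr => j _.
exact: (scale_exchange _ _ _ (fun i => koszul2 w i j) (fun i m => X (codiff2 (letter w i) (letter w j).2 :: unzip2 (remove i (remove j w)) ++ nseq m pi))).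
Qed.

End SeriesIdentity.

(** * Convergent sequences of homogeneous elements *)

Section Convergence.
Context {K : fieldType} {L : dgla K} (LL : lower_dgla L) (tau : graded_topology L).
Implicit Types (u v : nat -> L) (l m : L).

(** Only sequences of homogeneous elements of the given degree are controlled
    by the axioms of a graded topology. *)
(** The axioms of a graded topology only control homogeneous elements, hence the
    extra condition on the sequence itself. *)
Definition hcvg k u l := (forall N, homog k (u N)) /\ gcvg tau k u l.

Lemma eq_hcvg k u v l : u =1 v -> hcvg k u l -> hcvg k v l.
Proof. by move=> /funext ->. Qed.

Lemma near_homogB k U : nbhs0 tau k U -> exists2 V, nbhs0 tau k V &
  forall u l v m, homog k l -> homog k m ->
    (forall N, homog k (u N)) -> (forall N, homog k (v N)) ->
    (\forall N \near \oo, V (u N - l)) -> (\forall N \near \oo, V (v N - m)) ->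
    \forall N \near \oo, U ((u N - l) - (v N - m)).
Proof.
move=> /nbhs0_sub[V nV VU]; exists V => // u l v m hl hm hu hv ul vm.
near=> N; apply: VU.
- exact: (homogB LL).
- exact: (homogB LL).
- by near: N; exact: ul.
- by near: N; exact: vm.
Unshelve. all: by end_near. Qed.

Lemma hcvgB k u v l m : hcvg k u l -> hcvg k v m ->
  hcvg k (fun N => u N - v N) (l - m).
Proof.
move=> [hu [hl ul]] [hv [hm vm]]; split; first by move=> N; exact: homogB.
split; first exact: homogB.
move=> U /near_homogB[V nV /(_ u l v m hl hm hu hv (ul V nV) (vm V nV))].
apply: filterS => N.
by rewrite !opprB [X in U X -> _]addrACA [X in _ -> U X]addrACA [- l - _]addrC.
Qed.

Lemma hcvg_cst k l : homog k l -> hcvg k (fun=> l) l.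
Proof.
move=> hl; split=> //; split=> // U nU; near=> N.
by rewrite subrr; exact: (nbhs0_mem nU).
Unshelve. all: by end_near. Qed.

Lemma hcvgD k u v l m : hcvg k u l -> hcvg k v m ->
  hcvg k (fun N => u N + v N) (l + m).
Proof.
move=> cu cv.
have := hcvgB cu (hcvgB (hcvg_cst (homog0 LL k)) cv).
by rewrite sub0r opprK; under eq_fun do rewrite sub0r opprK.
Qed.

Lemma hcvgZ k (c : K) u l : hcvg k u l -> hcvg k (fun N => c *: u N) (c *: l).
Proof.
move=> [hu [hl ul]]; split; first by move=> N; exact: homogZ.
split; first exact: homogZ.
move=> U /(nbhs0_scale c)[V nV VU]; near=> N; rewrite -scalerBr; apply: VU.
  exact: homogB.
by near: N; exact: ul.
Unshelve. all: by end_near. Qed.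

Lemma hcvg_sum k n (u : nat -> nat -> L) (l : nat -> L) :
  (forall i, (i < n)%N -> hcvg k (u i) (l i)) ->
  hcvg k (fun N => \sum_(i < n) u i N) (\sum_(i < n) l i).
Proof.
elim: n => [|n IH] hu.
  by under eq_fun do rewrite big_ord0; rewrite big_ord0; exact: hcvg_cst (homog0 LL k).
under eq_fun do rewrite big_ord_recr; rewrite big_ord_recr /=.
by apply: hcvgD; [apply: IH => i ni; apply: hu; exact: ltnW|exact: hu].
Qed.

Lemma hcvg_dgd k u l : hcvg k u l -> hcvg (k + 1) (fun N => dgd (u N)) (dgd l).
Proof.
move=> [hu [hl ul]]; split; first by move=> N; exact: homog_d.
split; first exact: homog_d.
move=> U /nbhs0_dgd[V nV VU]; near=> N; rewrite -(dgdN LL) -(dgdD LL); apply: VU.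
  exact: homogB.
by near: N; exact: ul.
Unshelve. all: by end_near. Qed.

(** The degrees of the brackets enter as a hypothesis because [lower_dgla] only
    supplies them in a few cases. *)
Lemma hcvg_dgbr j k i (a : L) u l : homog j a ->
  (forall b, homog k b -> homog i (dgbr a b)) -> j + k = i ->
  hcvg k u l -> hcvg i (fun N => dgbr a (u N)) (dgbr a l).
Proof.
move=> ha hab ji [hu [hl ul]]; split; first by move=> N; exact: hab.
split; first exact: hab.
move=> U; rewrite -ji => /(nbhs0_dgbr ha)[V nV VU]; near=> N; rewrite -(dgbrrB LL ha); apply: VU.
  exact: homogB.
by near: N; exact: ul.
Unshelve. all: by end_near. Qed.

Lemma hcvg_shift k u l : hcvg k u l -> hcvg k (fun N => u N.+1) l.
Proof.
move=> [hu [hl ul]]; split=> //; split=> // U /ul [N _ NU].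
by exists N => // m /= Nm; apply: NU; exact: leqW.
Qed.

Lemma hcvg_unique k u l m : hcvg k u l -> hcvg k u m -> l = m.
Proof.
move=> cu cv; have [_ [_ uml]] := hcvgB cv cu.
apply/eqP; rewrite -subr_eq0; apply/eqP.
apply: (nbhs0_sep (g := tau) (homogB LL cu.2.1 cv.2.1)) => U /uml/filter_ex[N].
by rewrite subrr sub0r opprB.
Qed.
End Convergence.

(** * The twisted derivation *)

Section Twisting.
Context {K : fieldType} {L : dgla K} (LL : lower_dgla L) (tau : graded_topology L).
Hypothesis char0 : forall m, m.+1%:R != 0 :> K.
Local Notation word := (seq (int * L)).
Variables (pi : L) (X : seq L -> L).
Hypotheses (mc : maurer_cartan pi) (hX : linf_derivation X).
Hypothesis conv : series_converge tau X pi.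
Implicit Types w : word.
Local Notation S := (twist_series X pi).
Local Notation Phi := (twist tau X pi).
Let hpi : homog 1 pi := mc.1.

Lemma word_degree_pad w m : word_degree (w ++ nseq m (1%:Z, pi)) = word_degree w.
Proof.
rewrite /word_degree big_cat size_cat size_nseq /= big_nseq iter_addr_0 natz PoszD.
ring.
Qed.

Lemma hcvg_twist w : homog_word w -> hcvg tau (word_degree w) (S w) (Phi w).
Proof.
move=> hw; split=> [N|].
  apply: (homog_sum LL) => m _; apply: (homogZ LL).
  rewrite -unzip2_pad -(word_degree_pad w m); apply: (linf_degree hX).
  by apply: homog_cat => //; exact: homog_nseq.
by rewrite /twist /glim; apply: xgetPex; exact: conv.
Qed.

Lemma homog_twist w : homog_word w -> homog (word_degree w) (Phi w).
Proof. by move=> /hcvg_twist[_ []]. Qed.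

Lemma twist_seriesL w k (c : K) (a b : L) N : homog_word w -> homog k a -> homog k b ->
  S ((k, c *: a + b) :: w) N = c *: S ((k, a) :: w) N + S ((k, b) :: w) N.
Proof.
move=> hw ha hb; rewrite scaler_sumr -big_split; apply: eq_bigr => m _ /=.
rewrite scalerA mulrC -scalerA -scalerDr -unzip2_pad; congr (_ *: _).
apply: (linf_linear hX (w1 := [::])) ha hb => //.
by apply: homog_cat => //; exact: homog_nseq.
Qed.

Lemma twistL w k (c : K) (a b : L) : homog_word w -> homog k a -> homog k b ->
  Phi ((k, c *: a + b) :: w) = c *: Phi ((k, a) :: w) + Phi ((k, b) :: w).
Proof.
move=> hw ha hb; apply: (hcvg_unique LL (hcvg_twist (homog_cons _ hw))).
  exact: (homogL LL).
apply: eq_hcvg (fun N => esym (twist_seriesL c N hw ha hb)) _.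
rewrite !word_degree_cons /=.
apply: (hcvgD LL); first apply: (hcvgZ LL).
  by have := hcvg_twist (homog_cons ha hw); rewrite word_degree_cons.
by have := hcvg_twist (homog_cons hb hw); rewrite word_degree_cons.
Qed.

Lemma twist0 w k : homog_word w -> Phi ((k, 0) :: w) = 0.
Proof.
move=> hw; have := twistL 1 hw (homog0 LL k) (homog0 LL k).
by rewrite !scale1r addr0 -[X in X = _]addr0 => /addrI.
Qed.

(** In the limit the terms with d pi and with half of [pi, pi] cancel by the
    Maurer-Cartan equation, while the brackets with a single copy of [pi] turn d
    into the twisted differential.  The hypotheses say that every bracket that
    occurs is homogeneous of the expected degree, which is what makes limits
    unique. *)
Lemma twisted_comm w : homog_word w ->
  (forall b, homog (word_degree w) b -> homog (word_degree w + 1) (dgbr pi b)) ->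
  (forall i b, (i < size w)%N -> homog (word_degree (remove i w)) b ->
     homog (word_degree w + 1) (dgbr (letter w i).2 b)) ->
  (forall i, (i < size w)%N -> homog ((letter w i).1 + 1) (dgbr pi (letter w i).2)) ->
  (forall i j, (i < j)%N -> (j < size w)%N ->
     homog ((letter w i).1 + (letter w j).1) (dgbr (letter w i).2 (letter w j).2)) ->
  twisted_diff pi (Phi w) +
  \sum_(i < size w) koszul1 w i *: codiff2 (letter w i) (Phi (remove i w)) =
  \sum_(i < size w) koszul1 w i *:
    Phi (((letter w i).1 + 1, twisted_diff pi (letter w i).2) :: remove i w) +
  \sum_(j < size w) \sum_(i < j) koszul2 w i j *:
    Phi (((letter w i).1 + (letter w j).1, codiff2 (letter w i) (letter w j).2) ::
       remove i (remove j w)).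
Proof.
move=> hw br_pi br_w d_w br_ww.
have cS v k : homog_word v -> word_degree v = k ->
    hcvg tau k (fun N => S v N.+1) (Phi v).
  by move=> hv <-; apply: hcvg_shift; exact: hcvg_twist.
have hdpi : homog 2 (dgd pi) := homog_d LL hpi.
have pipi : dgbr pi pi = - 2%:R *: dgd pi.
  have := mc.2 => /eqP; rewrite addr_eq0 => /eqP ->.
  by rewrite scalerN scaleNr opprK scalerA mulfV ?char0 // scale1r.
have hpipi : homog 2 (dgbr pi pi) by rewrite pipi; exact: (homogZ LL).
pose k := word_degree w + 1.
(* Both sides of the relation between partial sums converge in degree k. *)
have lhs : hcvg tau k
  (fun N => dgd (S w N.+2) +
    \sum_(i < size w) koszul1 w i *: codiff2 (letter w i) (S (remove i w) N.+2) +
    dgbr pi (S w N.+1))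
  (dgd (Phi w) +
    \sum_(i < size w) koszul1 w i *: codiff2 (letter w i) (Phi (remove i w)) +
    dgbr pi (Phi w)).
  apply: (hcvgD LL); first apply: (hcvgD LL).
  - by apply: (hcvg_dgd LL); apply: (hcvg_shift (u := fun N => S w N.+1)); exact: cS.
  - apply: (hcvg_sum LL (u := fun i N => koszul1 w i *:
      codiff2 (letter w i) (S (remove i w) N.+2)) (l := fun i => koszul1 w i *:
      codiff2 (letter w i) (Phi (remove i w)))) => i iw.
    apply: (hcvgZ LL); apply: (hcvgZ LL).
    apply: (hcvg_dgbr LL (homog_letter hw iw) (br_w i ^~ iw)).
      by rewrite word_degree_remove // /k; ring.
    apply: (hcvg_shift (u := fun N => S (remove i w) N.+1)).
    by apply: cS => //; exact: homog_remove.
  - apply: (hcvg_dgbr LL hpi br_pi); first by rewrite addrC.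
    exact: cS.
have hrem i : homog_word (remove i w) := homog_remove hw.
have degc i l (x : L) : (i < size w)%N -> l = (letter w i).1 + 1 ->
    word_degree ((l, x) :: remove i w) = k.
  by move=> iw ->; rewrite word_degree_cons /= word_degree_remove // /k; ring.
have dl i : (i < size w)%N -> homog ((letter w i).1 + 1) (dgd (letter w i).2).
  by move=> iw; apply: (homog_d LL); exact: homog_letter.
have rhs : hcvg tau k
  (fun N => \sum_(i < size w) koszul1 w i *:
    S (((letter w i).1 + 1, dgd (letter w i).2) :: remove i w) N.+2 +
  S ((2, dgd pi) :: w) N.+1 +
  (\sum_(j < size w) \sum_(i < j) koszul2 w i j *:
     S (((letter w i).1 + (letter w j).1, codiff2 (letter w i) (letter w j).2) ::
        remove i (remove j w)) N.+2 +
   \sum_(i < size w) koszul1 w i *: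
     S (((letter w i).1 + 1, dgbr pi (letter w i).2) :: remove i w) N.+1 +
   2%:R^-1 *: S ((2, dgbr pi pi) :: w) N))
  (\sum_(i < size w) koszul1 w i *:
    Phi (((letter w i).1 + 1, dgd (letter w i).2) :: remove i w) +
  Phi ((2, dgd pi) :: w) +
  (\sum_(j < size w) \sum_(i < j) koszul2 w i j *:
     Phi (((letter w i).1 + (letter w j).1, codiff2 (letter w i) (letter w j).2) ::
        remove i (remove j w)) +
   \sum_(i < size w) koszul1 w i *:
     Phi (((letter w i).1 + 1, dgbr pi (letter w i).2) :: remove i w) +
   2%:R^-1 *: Phi ((2, dgbr pi pi) :: w))).
  apply: (hcvgD LL); apply: (hcvgD LL).
  - apply: (hcvg_sum LL (u := fun i N => koszul1 w i *:
      S (((letter w i).1 + 1, dgd (letter w i).2) :: remove i w) N.+2)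
      (l := fun i => koszul1 w i *:
      Phi (((letter w i).1 + 1, dgd (letter w i).2) :: remove i w))) => i iw.
    apply: (hcvgZ LL).
    apply: (hcvg_shift (u := fun N => S (((letter w i).1 + 1, _) :: _) N.+1)).
    by apply: cS; [apply: homog_cons => //; exact: dl|exact: degc].
  - apply: cS; first exact: homog_cons.
    by rewrite word_degree_cons /= /k; ring.
  - apply: (hcvgD LL).
      apply: (hcvg_sum LL (u := fun j N => \sum_(i < j) koszul2 w i j *:
        S (((letter w i).1 + (letter w j).1, codiff2 (letter w i) (letter w j).2) ::
        remove i (remove j w)) N.+2) (l := fun j => \sum_(i < j) koszul2 w i j *:
        Phi (((letter w i).1 + (letter w j).1, codiff2 (letter w i) (letter w j).2) ::
        remove i (remove j w)))) => j jw.
      apply: (hcvg_sum LL (u := fun i N => koszul2 w i j *: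
        S (((letter w i).1 + (letter w j).1, codiff2 (letter w i) (letter w j).2) ::
        remove i (remove j w)) N.+2) (l := fun i => koszul2 w i j *:
        Phi (((letter w i).1 + (letter w j).1, codiff2 (letter w i) (letter w j).2) ::
        remove i (remove j w)))) => i ij.
      apply: (hcvgZ LL).
      apply: (hcvg_shift (u := fun N => S ((_, codiff2 _ _) :: _) N.+1)).
      have ijw : (i < size (remove j w))%N.
        by rewrite size_cat size_take jw (leq_trans ij) ?leq_addr.
      apply: cS; last first.
        rewrite word_degree_cons /= !word_degree_remove // letter_remove // /k; ring.
      apply: homog_cons; last exact: homog_remove.
      by apply: (homogZ LL); exact: br_ww.
    apply: (hcvg_sum LL (u := fun i N => koszul1 w i *:
      S (((letter w i).1 + 1, dgbr pi (letter w i).2) :: remove i w) N.+1)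
      (l := fun i => koszul1 w i *:
      Phi (((letter w i).1 + 1, dgbr pi (letter w i).2) :: remove i w))) => i iw.
    apply: (hcvgZ LL).
    by apply: cS; [apply: homog_cons => //; exact: d_w|exact: degc].
  - apply: (hcvgZ LL).
    have -> : k = word_degree ((2, dgbr pi pi) :: w) by rewrite word_degree_cons /= /k; ring.
    by apply: hcvg_twist; exact: homog_cons.
have := hcvg_unique LL (eq_hcvg (fun N => twist_series_comm LL char0 hpi hX N hw) lhs) rhs.
have -> : Phi ((2, dgbr pi pi) :: w) = - 2%:R *: Phi ((2, dgd pi) :: w).
  have := twistL (- 2%:R) hw hdpi (homog0 LL 2).
  by rewrite addr0 -pipi twist0 // addr0.
rewrite scalerA mulrN mulVf ?char0 // scaleN1r => E.
rewrite /twisted_diff addrAC E.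
rewrite addrACA addrN addr0 addrCA [in RHS]addrC; congr (_ + _); rewrite -big_split.
apply: eq_bigr => i _ /=; rewrite -scalerDr; congr (_ *: _).
have := twistL 1 (hrem i) (dl i (ltn_ord i)) (d_w i (ltn_ord i)).
by rewrite !scale1r => ->.
Qed.
End Twisting.

(** * Vanishing of the derived bracket *)

Section LowDegrees.
Context {K : fieldType} {L : dgla K}.
Implicit Types a b : L.

Lemma codiff2N1 a b : codiff2 (-1, a) b = dgbr a b.
Proof. by rewrite /codiff2 /sdeg /= sqrrN expr1n scale1r. Qed.

Lemma codiff20 a b : codiff2 (0, a) b = - dgbr a b.
Proof. by rewrite /codiff2 /sdeg /= expr1 scaleN1r. Qed.

Lemma codiff21 a b : codiff2 (1, a) b = dgbr a b.
Proof. by rewrite /codiff2 /sdeg /= expr0 scale1r. Qed.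

End LowDegrees.

Section Nijenhuis.
Context {K : fieldType} {L : dgla K} (LL : lower_dgla L) (tau : graded_topology L).
Hypothesis char0 : forall m, m.+1%:R != 0 :> K.
Variables (pi : L) (X : seq L -> L).
Hypotheses (mc : maurer_cartan pi) (hX : linf_derivation X).
Hypothesis conv : series_converge tau X pi.
Hypothesis nij : weak_nijenhuis tau X pi.
Local Notation Phi := (twist tau X pi).
Local Notation xi := (apply_mc tau X pi).
Let hpi : homog 1 pi := mc.1.

Lemma homog_apply_mc : homog 1 xi.
Proof. by have := homog_twist LL mc hX conv homog_nil; rewrite word_degree_nil. Qed.

(** The twisted relation for the empty word. *)
Lemma twisted_diff_apply_mc : twisted_diff pi xi = 0.
Proof.
have := twisted_comm LL char0 mc hX conv homog_nil.
rewrite !big_ord0 /= !addr0 word_degree_nil; apply=> //.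
by move=> b; exact: (homog_br11 LL hpi).
Qed.

Section Casimir.
Variable f : L.
Hypotheses (hf : homog (-1) f) (df : twisted_diff pi f = 0).
Local Notation F := (Phi [:: (-1, f)]).
Local Notation eta := (dgbr xi f).

Lemma homog_tangent : homog (-1) F.
Proof.
have := homog_twist LL mc hX conv (homog_cons hf homog_nil).
by rewrite word_degree_cons word_degree_nil.
Qed.

Lemma br_casimir : dgbr pi f = 0.
Proof. by have := df; rewrite /twisted_diff (d_fun LL hf) add0r. Qed.

Lemma homog_eta : homog 0 eta.
Proof. exact: (homog_br1N LL homog_apply_mc hf). Qed.

(** The twisted relation for the word f: since f is closed, d_pi F is the bracket
    of f with the constant term xi. *)
Lemma br_tangent : dgbr pi F = - eta.
Proof.
have hw := homog_cons hf homog_nil.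
refine (_ (twisted_comm LL char0 mc hX conv hw _ _ _ _)).
- rewrite !big_ord_recl !big_ord0 /= /remove /= /letter /= df (twist0 LL mc hX conv) //.
  rewrite scaler0 !addr0 /koszul1 /codiff2 /sdeg /= !big_ord0 muln0 !scale1r.
  rewrite expr2 mulrNN !mulr1 scale1r.
  rewrite /twisted_diff (d_fun LL homog_tangent) add0r (dgbr_sym1N LL homog_apply_mc hf).
  by move=> E; apply/eqP; rewrite -addr_eq0 E.
- rewrite word_degree_cons word_degree_nil => b; exact: (homog_br1N LL hpi).
- case=> // b _; rewrite /= /remove /= word_degree_cons word_degree_nil => hb.
  rewrite (dgbr_sym1N LL hb hf).
  exact: (homog_br1N LL hb hf).
- by case=> // _; rewrite br_casimir; exact: (homog0 LL).
- by case=> [|i] [|[|j]].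
Qed.

(** [eta] is exact for d_pi by [br_tangent], and the square of d_pi vanishes on
    functions by the Maurer-Cartan equation. *)
Lemma twisted_diff_eta : twisted_diff pi eta = 0.
Proof.
have hF := homog_tangent; have hbr := homog_br1N LL hpi hF.
have -> : eta = - dgbr pi F by rewrite br_tangent opprK.
rewrite /twisted_diff (dgdN LL) (dgbrrN LL hpi) -opprD (d_br1N LL hpi hF).
have := jacobi11N LL hpi hpi hF; rewrite -mulr2n -scaler_nat => /(canRL (scalerK (char0 1))) ->.
have hdpi : homog 2 (dgd pi) := homog_d LL hpi.
have hpp := homog_br11 LL hpi hpi.
rewrite -(dgbrlZ LL hF _ hpp) -(dgbrlD LL hF hdpi (homogZ LL _ hpp)) mc.2.
by rewrite (dgbrl0 LL hF) oppr0.
Qed.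

(** The twisted relation for the word (f, xi).  Both letters are closed, and the
    term [f, Phi(xi)] is zero by the weak Nijenhuis property. *)
Lemma br_xi_tangent : dgbr pi (Phi [:: (-1, f); (1, xi)]) + dgbr xi F = Phi [:: (0, eta)].
Proof.
have hxi := homog_apply_mc.
have hxw := homog_cons hxi homog_nil.
have hfw := homog_cons hf homog_nil.
have hw := homog_cons hf hxw.
have deg_w : word_degree [:: (-1, f); (1, xi)] = -1.
  by rewrite !word_degree_cons word_degree_nil.
refine (_ (twisted_comm LL char0 mc hX conv hw _ _ _ _)).
- rewrite !big_ord_recl !big_ord0 /= /remove /= /letter /= df twisted_diff_apply_mc.
  rewrite !(twist0 LL mc hX conv) //.
  rewrite !scaler0 !addr0 !add0r /koszul2 /koszul1 /= !mul0n.
  rewrite !big_ord0 !muln0 !expr0 !mulr1 !scale1r !codiff2N1 codiff21.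
  have -> : Phi [:: (1, xi)] = 0 := nij.
  rewrite (dgbrr0 LL hf) add0r (dgbr_sym1N LL hxi hf) /twisted_diff.
  rewrite (d_fun LL) ?add0r //.
  by have := homog_twist LL mc hX conv hw; rewrite deg_w.
- by rewrite deg_w => b; exact: (homog_br1N LL hpi).
- rewrite deg_w => -[|[|//]] b _; rewrite /remove /= word_degree_cons word_degree_nil => hb.
    by rewrite (dgbr_sym1N LL hb hf); exact: (homog_br1N LL hb hf).
  exact: (homog_br1N LL hxi hb).
- move=> [|[|//]] _ /=; first by rewrite br_casimir; exact: (homog0 LL).
  exact: (homog_br11 LL hpi hxi).
- move=> [|i] [|[|//]] //= _ _; rewrite (dgbr_sym1N LL hxi hf); exact: homog_eta.
Qed.

(** The derived bracket with a function annihilated by [pi] vanishes, by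
    antisymmetry. *)
Lemma br_fun_twisted u g : homog (-1) u -> homog (-1) g -> dgbr pi g = 0 ->
  dgbr g (dgbr pi u) = 0.
Proof. by move=> hu hg g0; rewrite (derived_anti LL hpi hg hu) g0 (dgbrr0 LL hu) oppr0. Qed.

End Casimir.

Section TwoCasimirs.
Variables f g : L.
Hypotheses (hf : homog (-1) f) (df : twisted_diff pi f = 0).
Hypotheses (hg : homog (-1) g) (dg : twisted_diff pi g = 0).
Local Notation F := (Phi [:: (-1, f)]).
Local Notation G := (Phi [:: (-1, g)]).
Local Notation eta := (dgbr xi f).

(** The twisted relation for the word (g, eta).  Its letters are closed,
    Phi(g, eta) lies in degree -2, and [g, eta] = - [g, [pi, F]] = 0, so that only
    the brackets with Phi(g) and Phi(eta) remain. *)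
Lemma br_fun_twist_eta : dgbr g (Phi [:: (0, eta)]) = dgbr eta G.
Proof.
have heta := homog_eta hf.
have gpi := br_casimir hg dg.
have hew := homog_cons heta homog_nil.
have hw := homog_cons hg hew.
have deg_w : word_degree [:: (-1, g); (0, eta)] = -2.
  by rewrite !word_degree_cons word_degree_nil.
have pi_eta : dgbr pi eta = - dgd eta.
  by apply/eqP; rewrite -addr_eq0 addrC; apply/eqP; exact: (twisted_diff_eta hf df).
refine (_ (twisted_comm LL char0 mc hX conv hw _ _ _ _)).
- rewrite !big_ord_recl !big_ord0 /= /remove /= /letter /= dg (twisted_diff_eta hf df).
  rewrite !(twist0 LL mc hX conv) //; last exact: homog_cons hg homog_nil.
  rewrite !codiff2N1 codiff20.
  have -> : dgbr g eta = 0.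
    rewrite -[eta]opprK -(br_tangent hf df) (dgbrrN LL hg).
    by rewrite (br_fun_twisted (homog_tangent hf) hg gpi) oppr0.
  rewrite (twist0 LL mc hX conv) // !scaler0 !addr0 /koszul1 /bump /=.
  rewrite big_ord_recl !big_ord0 muln0 expr0 /sdeg /= sqrrN expr1n !scale1r.
  have -> : Phi [:: (-1, g); (0, eta)] = 0.
    apply: (homog_low LL (k := -2)) => //.
    by have := homog_twist LL mc hX conv hw; rewrite deg_w.
  rewrite /twisted_diff (dgd0 LL) (dgbrr0 LL hpi) !add0r => /eqP.
  by rewrite subr_eq0 => /eqP.
- rewrite deg_w => b /(homog_low LL) -> //; rewrite (dgbrr0 LL hpi); exact: (homog0 LL).
- rewrite deg_w => -[|[|//]] b _; rewrite /remove /= word_degree_cons word_degree_nil => hb.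
    by rewrite (dgbr_anti0N LL hb hg) -scaleN1r; apply: (homogZ LL); exact: (homog_br0N LL hb hg).
  exact: (homog_br0N LL heta hb).
- move=> [|[|//]] _ /=; first by rewrite gpi; exact: (homog0 LL).
  by rewrite pi_eta -scaleN1r; apply: (homogZ LL); exact: (homog_d LL heta).
- move=> [|i] [|[|//]] //= _ _.
  rewrite (dgbr_anti0N LL heta hg) -scaleN1r; apply: (homogZ LL); exact: (homog_br0N LL).
Qed.

(** The relations for f, (f, xi) and (g, eta) show that the derived bracket of F
    and G equals its own opposite. *)
Lemma derived_bracket_tangent : derived_bracket pi F G = 0.
Proof.
have hxi := homog_apply_mc; have hF := homog_tangent hf; have hG := homog_tangent hg.
have gpi := br_casimir hg dg.
have hu : homog (-1) (Phi [:: (-1, f); (1, xi)]).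
  have := homog_twist LL mc hX conv (homog_cons hf (homog_cons hxi homog_nil)).
  by rewrite !word_degree_cons word_degree_nil.
have E : dgbr F (dgbr pi G) = - dgbr F (dgbr pi G).
  rewrite {1}(br_tangent hg dg) (dgbrrN LL hF) (derived_anti LL hxi hF hg) opprK.
  have /(canRL (addKr _)) -> := br_xi_tangent hf df.
  rewrite (dgbrrD LL hg) (dgbrrN LL hg) (br_fun_twisted hu hg gpi) oppr0 add0r.
  rewrite br_fun_twist_eta -[eta]opprK -(br_tangent hf df) -(derived_anti LL hpi hG hF).
  have hpF := homog_br1N LL hpi hF.
  by rewrite (dgbr_anti0N LL hpF hG) -[- dgbr pi F]scaleN1r (dgbrlZ LL hG _ hpF) scaleN1r.
rewrite /derived_bracket; apply/eqP; move/eqP: E.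
rewrite -addr_eq0 -mulr2n -scaler_nat scaler_eq0 => /orP[] // two0.
by have := char0 1; rewrite two0.
Qed.

End TwoCasimirs.
End Nijenhuis.

(** * Formal power series *)

Section TripleSums.
Context {V : zmodType}.
Implicit Types F : nat -> nat -> nat -> V.

(** Both iterated convolutions of three series are brought to this symmetric
    form, where the variables can be permuted. *)
Definition conv3 F i : V :=
  \sum_(j < i.+1) \sum_(l < i.+1) \sum_(m < i.+1 | (j + l + m)%N == i) F j l m.

Lemma sum_complement n (a i : nat) (G : nat -> V) : (i < n)%N ->
  \sum_(m < n | (a + m)%N == i) G m = if (a <= i)%N then G (i - a)%N else 0.
Proof.
move=> i_n; case: leqP => ai; last first.
  by rewrite big1 // => m /eqP E; move: ai; rewrite -E ltnNge leq_addr.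
have ia : (i - a < n)%N by rewrite (leq_ltn_trans (leq_subr _ _)).
rewrite (big_pred1 (Ordinal ia)) // => m /=.
by rewrite -(inj_eq val_inj) /=; apply/eqP/eqP; lia.
Qed.

Lemma conv3_right F i : conv3 F i =
  \sum_(j < i.+1) \sum_(l < (i - j).+1) F j l (i - j - l)%N.
Proof.
apply: eq_bigr => j _.
rewrite (big_ord_widen i.+1 (fun l => F j l (i - j - l)%N)) ?ltnS ?leq_subr //.
rewrite [RHS]big_mkcond; apply: eq_bigr => l _.
rewrite sum_complement // ltnS -subnDA; congr (if _ then _ else _).
by have := ltn_ord j; rewrite ltnS; lia.
Qed.

Lemma conv3_swap12 F i : conv3 F i = conv3 (fun j l m => F l j m) i.
Proof.
rewrite /conv3 exchange_big; apply: eq_bigr => j _; apply: eq_bigr => l _.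
by apply: eq_bigl => m; rewrite addnAC [(l + m + j)%N]addnAC [(l + j)%N]addnC.
Qed.

Lemma conv3_swap23 F i : conv3 F i = conv3 (fun j l m => F j m l) i.
Proof.
rewrite /conv3; apply: eq_bigr => j _.
under eq_bigr => l _ do rewrite big_mkcond.
rewrite exchange_big; apply: eq_bigr => l _; rewrite [RHS]big_mkcond.
by apply: eq_bigr => m _; rewrite addnAC.
Qed.

Lemma conv3_left F i : conv3 F i =
  \sum_(j < i.+1) \sum_(l < j.+1) F l (j - l)%N (i - j)%N.
Proof.
rewrite conv3_swap23 conv3_swap12 conv3_right.
rewrite (reindex_inj rev_ord_inj) /=; apply: eq_bigr => j _.
rewrite subSS subKn; last by rewrite -ltnS.
by [].
Qed.

Lemma eq_conv3 F G i : (forall j l m, F j l m = G j l m) -> conv3 F i = conv3 G i.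
Proof. by move=> FG; do 3!apply: eq_bigr => ? _; exact: FG. Qed.

Lemma conv3D F G i : conv3 F i + conv3 G i = conv3 (fun j l m => F j l m + G j l m) i.
Proof. by rewrite /conv3; do 3!(rewrite -big_split; apply: eq_bigr => ? _). Qed.

Lemma conv3N F i : - conv3 F i = conv3 (fun j l m => - F j l m) i.
Proof. by rewrite /conv3; do 3!(rewrite -sumrN; apply: eq_bigr => ? _). Qed.

End TripleSums.

(** Every identity in [lower_dgla] is multilinear, so it passes to power series
    coefficient by coefficient; this is why [jacobi11N] is stated for two distinct
    elements of degree 1. *)
Lemma lower_formal (K : fieldType) (L : dgla K) : lower_dgla L -> lower_dgla (formal L).
Proof.
move=> LL.
split; rewrite /= /mkset.
- by move=> k i; exact: (homog0 LL).
- by move=> k c a b ha hb i; exact: (homogL LL).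
- by move=> k a kN ha; apply/funext => i; exact: (homog_low LL kN).
- by move=> c a b; apply/funext => i; exact: (dgdL LL).
- by move=> k a ha i; exact: (homog_d LL).
- by move=> a ha; apply/funext => i; exact: (d_fun LL).
- move=> k c a b b' ha; apply/funext => i /=.
  rewrite !fctE scaler_sumr -big_split; apply: eq_bigr => j _ /=.
  exact: (dgbrL LL _ _ _ (ha j)).
- move=> j k a b ha hb; apply/funext => i.
  rewrite !fctE scaler_sumr [RHS](reindex_inj rev_ord_inj); apply: eq_bigr => l _ /=.
  by rewrite subSS (dgbr_anti LL (ha l) (hb _)) subKn // -ltnS.
- by move=> a b ha hb i; apply: (homog_sum LL) => j _; exact: (homog_br11 LL (ha _) (hb _)).
- by move=> a b ha hb i; apply: (homog_sum LL) => j _; exact: (homog_br1N LL (ha _) (hb _)).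
- by move=> a b ha hb i; apply: (homog_sum LL) => j _; exact: (homog_br0N LL (ha _) (hb _)).
- move=> p a b hp ha hb; apply/funext => i; rewrite !fctE.
  under eq_bigr => j _ do rewrite (dgbrr_sum LL (ha _)).
  under [in RHS]eq_bigr => j _ do rewrite (dgbrr_sum LL (hb _)).
  rewrite -(conv3_right (fun j l m => dgbr (a j) (dgbr (p l) (b m)))).
  rewrite -(conv3_right (fun j l m => dgbr (b j) (dgbr (p l) (a m)))).
  rewrite [in RHS]conv3_swap12 [in RHS]conv3_swap23 [in RHS]conv3_swap12 conv3N.
  by apply: eq_conv3 => j l m; exact: (derived_anti LL (hp _) (ha _) (hb _)).
- move=> p q a hp hq ha; apply/funext => i; rewrite !fctE.
  under eq_bigr => j _ do rewrite (dgbrr_sum LL (hp _)).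
  under [X in _ + X = _]eq_bigr => j _ do rewrite (dgbrr_sum LL (hq _)).
  have brl j : dgbr (\sum_(l < j.+1) dgbr (p l) (q (j - l)%N)) (a (i - j)%N) =
      \sum_(l < j.+1) dgbr (dgbr (p l) (q (j - l)%N)) (a (i - j)%N).
    by apply: (dgbrl_sum LL (ha _)) => l _; exact: (homog_br11 LL (hp _) (hq _)).
  under [in RHS]eq_bigr => j _ do rewrite brl.
  rewrite -(conv3_right (fun j l m => dgbr (p j) (dgbr (q l) (a m)))).
  rewrite -(conv3_right (fun j l m => dgbr (q j) (dgbr (p l) (a m)))).
  rewrite -(conv3_left (fun j l m => dgbr (dgbr (p j) (q l)) (a m))).
  rewrite [X in _ + X]conv3_swap12 conv3D.
  by apply: eq_conv3 => j l m; exact: (jacobi11N LL (hp _) (hq _) (ha _)).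
- move=> p a hp ha; apply/funext => i; rewrite (dgd_sum LL).
  by apply: eq_bigr => j _; exact: (d_br1N LL (hp _) (ha _)).
Qed.

(** * Brackets defined by insertion of cochains *)

Section Multilinear.
Context {K : fieldType} {A : lmodType K}.
Local Notation cochain := (seq A -> A).
Implicit Types (P Q : cochain) (s : seq A).

Lemma cochain_size p P s : is_cochain p P -> size s <> p -> P s = 0.
Proof. by move=> [Ps _]; exact: Ps. Qed.

Lemma cochain_entry0 p P s1 s2 : is_cochain p P -> P (s1 ++ 0 :: s2) = 0.
Proof.
move=> [_ /(_ s1 s2 1 0 0)]; rewrite !scale1r addr0.
by rewrite -[X in X = _]addr0 => /addrI.
Qed.

Lemma cochain_entryN p P s1 s2 x : is_cochain p P ->
  P (s1 ++ - x :: s2) = - P (s1 ++ x :: s2).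
Proof.
move=> cP; have [_ /(_ s1 s2 (-1) x 0)] := cP.
by rewrite (cochain_entry0 _ _ cP) !addr0 !scaleN1r.
Qed.

Lemma cochain_entryD p P s1 s2 x y : is_cochain p P ->
  P (s1 ++ (x + y) :: s2) = P (s1 ++ x :: s2) + P (s1 ++ y :: s2).
Proof. by move=> [_ /(_ s1 s2 1 x y)]; rewrite !scale1r. Qed.

Lemma is_cochain0 p : is_cochain p (0 : cochain).
Proof.
split=> // s1 s2 c f g.
by rewrite -[LHS]/(0 : A) -[RHS]/(c *: (0 : A) + 0) scaler0 addr0.
Qed.

Lemma is_cochainL p c P Q :
  is_cochain p P -> is_cochain p Q -> is_cochain p (c *: P + Q).
Proof.
move=> cP cQ; split=> [s sp|s1 s2 c' f g]; rewrite !fctE.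
  by rewrite (cochain_size cP) // (cochain_size cQ) // scaler0 addr0.
rewrite cP.2 cQ.2 !scalerDr addrACA !scalerA [c' * c]mulrC; congr (_ + _).
Qed.

(** The properties of an insertion operation that make its commutator a graded
    bracket. *)
Record multilinear_insertion (ins : nat -> nat -> cochain -> cochain -> cochain) : Prop := {
  ins_arity : forall p q p' q' P Q s, is_cochain p P -> is_cochain q Q ->
    (p' + q')%N = (size s).+1 -> (p', q') <> (p, q) -> ins p' q' P Q s = 0;
  insL : forall p q c P P' Q s,
    ins p q (c *: P + P') Q s = c *: ins p q P Q s + ins p q P' Q s;
  insR : forall r p q c P Q Q' s, is_cochain r P ->
    ins p q P (c *: Q + Q') s = c *: ins p q P Q s + ins p q P Q' s;
  ins_cochain : forall p q P Q, is_cochain p P -> is_cochain q Q ->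
    is_cochain (p + q).-1 (ins p q P Q) }.

Section Bracket.
Variable ins : nat -> nat -> cochain -> cochain -> cochain.
Hypothesis insP : multilinear_insertion ins.
Local Notation br := (insertion_bracket ins).

(** The sum over all splittings of the arity that defines the bracket has a
    single nonzero term. *)
Lemma insertion_bracketE p q P Q s : is_cochain p P -> is_cochain q Q ->
  (p + q)%N = (size s).+1 ->
  br P Q s = ins p q P Q s - (-1) ^+ (p.+1 * q.+1) *: ins q p Q P s.
Proof.
move=> cP cQ pq; have qs : (q < (size s).+2)%N by lia.
rewrite /insertion_bracket (bigD1 (Ordinal qs)) //= big1 ?addr0.
  by have -> : ((size s).+1 - q = p)%N by lia.
move=> q' /negP q'q.
have ne : (q' : nat) <> q by move=> E; apply: q'q; apply/eqP/val_inj.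
have q's := ltn_ord q'.
rewrite (ins_arity insP cP cQ) ?(ins_arity insP cQ cP) ?subr0 ?scaler0 ?subr0 //.
- lia.
- by move=> [/ne].
- lia.
- by move=> [_ /ne].
Qed.

Lemma insertion_bracket_size p q P Q s : is_cochain p P -> is_cochain q Q ->
  (p + q)%N <> (size s).+1 -> br P Q s = 0.
Proof.
move=> cP cQ pq; rewrite /insertion_bracket big1 // => q' _; have q's := ltn_ord q'.
rewrite (ins_arity insP cP cQ) ?(ins_arity insP cQ cP) ?scaler0 ?subr0 //.
- lia.
- by move=> [E1 E2]; apply: pq; lia.
- lia.
- by move=> [E1 E2]; apply: pq; lia.
Qed.

Lemma insertion_bracketR p c P Q Q' : is_cochain p P ->
  br P (c *: Q + Q') = c *: br P Q + br P Q'.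
Proof.
move=> cP; apply/funext => s; rewrite !fctE /insertion_bracket scaler_sumr -big_split.
apply: eq_bigr => q _ /=; rewrite (insL insP) (insR insP _ _ _ _ _ _ cP).
by rewrite scalerDr scalerBr !scalerA [_ * c]mulrC opprD addrACA.
Qed.

Lemma insertion_bracket0 p P : is_cochain p P -> br P 0 = 0.
Proof.
move=> cP; have := insertion_bracketR 1 0 0 cP; rewrite !scale1r addr0.
by rewrite -[X in X = _]addr0 => /addrI.
Qed.

Lemma insertion_bracket_anti p q P Q : is_cochain p P -> is_cochain q Q ->
  br P Q = - (-1) ^+ (p.+1 * q.+1) *: br Q P.
Proof.
move=> cP cQ; apply/funext => s; rewrite !fctE.
have [pq|pq] := eqVneq (p + q)%N (size s).+1; last first.
  rewrite (insertion_bracket_size cP cQ); last exact/eqP.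
  by rewrite (insertion_bracket_size cQ cP) ?scaler0 // addnC; exact/eqP.
rewrite (insertion_bracketE cP cQ pq) (insertion_bracketE cQ cP) 1?addnC //.
rewrite scalerBr !scaleNr scalerA [(q.+1 * _)%N]mulnC -expr2 sqrr_sign scale1r.
by rewrite opprK addrC.
Qed.

Lemma insertion_bracket_cochain p q P Q : is_cochain p P -> is_cochain q Q ->
  is_cochain (p + q).-1 (br P Q).
Proof.
move=> cP cQ.
have [pq0|pq0] := posnP (p + q).
  have -> : br P Q = 0; last exact: is_cochain0.
  by apply/funext => s; rewrite (insertion_bracket_size cP cQ) ?pq0.
have brE s : br P Q s = if (size s).+1 == (p + q)%N
    then ins p q P Q s - (-1) ^+ (p.+1 * q.+1) *: ins q p Q P s else 0.
  case: eqP => [E|/nesym]; first exact: insertion_bracketE.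
  exact: insertion_bracket_size.
have cPQ := ins_cochain insP cP cQ; have cQP := ins_cochain insP cQ cP.
split=> [s sn|s1 s2 c f g].
  by rewrite brE; case: eqP => // E; case: sn; rewrite -E.
rewrite !brE !size_cat /=; case: eqP => _; last by rewrite scaler0 addr0.
rewrite cPQ.2 cQP.2 scalerBr scalerDr opprD addrACA; congr (_ - _ + _).
by rewrite !scalerA mulrC.
Qed.

End Bracket.
End Multilinear.

Section Gerstenhaber.
Context {K : fieldType} {A : lmodType K}.
Local Notation cochain := (seq A -> A).

(** Multilinearity: the entry that varies lies before, inside or after the block
    of entries passed to the inner cochain. *)
Lemma gerstenhaber_multilinear : multilinear_insertion (@gerstenhaber_ins K A).
Proof.
split.
- move=> p q p' q' P Q s cP cQ pqs ne; rewrite /gerstenhaber_ins big1 // => i _.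
  have ip := ltn_ord i.
  have sz : size (take q' (drop i s)) = q' by rewrite size_takel // size_drop; lia.
  have [qq'|/eqP qq'] := eqVneq q' q; last first.
    by rewrite (cochain_size cQ) ?sz // (cochain_entry0 _ _ cP) scaler0.
  rewrite (cochain_size cP) ?scaler0 // size_cat /= size_takel ?size_drop; last lia.
  by move=> E; apply: ne; rewrite qq'; congr (_, _); lia.
- move=> p q c P P' Q s; rewrite /gerstenhaber_ins scaler_sumr -big_split.
  by apply: eq_bigr => i _; rewrite /= !fctE scalerDr !scalerA mulrC.
- move=> r p q c P Q Q' s cP; rewrite /gerstenhaber_ins scaler_sumr -big_split.
  by apply: eq_bigr => i _; rewrite /= !fctE cP.2 scalerDr !scalerA mulrC.
- move=> p q P Q cP cQ; split=> [s sn|s1 s2 c f g]; rewrite /gerstenhaber_ins.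
    rewrite big1 // => i _; have ip := ltn_ord i.
    (* On a list shorter than i the block is empty; the inner cochain then need not
       vanish if its arity is 0, but the outer list has the wrong length. *)
    have [si|is_] := ltnP (size s) i.
      rewrite (cochain_size cP) ?scaler0 // size_cat /= take_oversize ?(ltnW si) //.
      by rewrite drop_oversize /=; lia.
    have [iqs|iqs] := leqP (i + q) (size s).
      rewrite (cochain_size cP) ?scaler0 // size_cat /= size_takel ?size_drop; last lia.
      by move=> E; apply: sn; lia.
    rewrite (cochain_size cQ) ?(cochain_entry0 _ _ cP) ?scaler0 //.
    by rewrite size_take size_drop; case: ifP; lia.
  rewrite scaler_sumr -big_split; apply: eq_bigr => i _ /=.
  rewrite [RHS]addrC scalerA mulrC -scalerA addrC -scalerDr; congr (_ *: _).
  have [s1i|is1] := ltnP (size s1) i.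
    have t x : take i (s1 ++ x :: s2) = s1 ++ x :: take (i - size s1).-1 s2.
      rewrite take_cat ltnNge (ltnW s1i) /=; congr (_ ++ _).
      by rewrite -subn_gt0 in s1i; case: (i - size s1)%N s1i.
    have d j x : (size s1 < j)%N -> drop j (s1 ++ x :: s2) = drop (j - size s1).-1 s2.
      move=> s1j; rewrite drop_cat ltnNge (ltnW s1j) /=.
      by rewrite -subn_gt0 in s1j; case: (j - size s1)%N s1j.
    by rewrite !t !d ?ltn_addr // -!catA !cat_cons cP.2.
  have t x : take i (s1 ++ x :: s2) = take i s1.
    rewrite take_cat; case: ltnP => // s1i; have -> : i = size s1 :> nat by lia.
    by rewrite subnn take0 cats0 take_size.
  have d x : drop i (s1 ++ x :: s2) = drop i s1 ++ x :: s2.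
    rewrite drop_cat; case: ltnP => // s1i; have -> : i = size s1 :> nat by lia.
    by rewrite subnn drop_size.
  rewrite !t !d; have [iqs|siq] := leqP (i + q) (size s1).
    have tq x : take q (drop i s1 ++ x :: s2) = take q (drop i s1).
      rewrite take_cat size_drop; case: ltnP => // s1i.
      have -> : q = (size s1 - i)%N by lia.
      by rewrite subnn take0 cats0 -size_drop take_size.
    have dq x : drop (i + q) (s1 ++ x :: s2) = drop (i + q) s1 ++ x :: s2.
      rewrite drop_cat; case: ltnP => // s1i; have -> : (i + q)%N = size s1 by lia.
      by rewrite subnn drop_size.
    by rewrite !tq !dq -!cat_cons !catA cP.2.
  have tq x : take q (drop i s1 ++ x :: s2) =
      drop i s1 ++ x :: take (q - (size s1 - i)).-1 s2.
    rewrite take_cat size_drop ifF; last by lia.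
    congr (_ ++ _); have : (0 < q - (size s1 - i))%N by lia.
    by case: (q - _)%N.
  have dq x : drop (i + q) (s1 ++ x :: s2) = drop (i + q - size s1).-1 s2.
    rewrite drop_cat ifF; last by lia.
    have : (0 < i + q - size s1)%N by lia.
    by case: (_ - _)%N.
  by rewrite !tq !dq cQ.2 cP.2.
Qed.
End Gerstenhaber.

Section Unshuffle.
Context {K : fieldType} {A : lmodType K}.
Local Notation cochain := (seq A -> A).

Lemma unshuffle_insE n p q (P Q : cochain) s : size s = n ->
  unshuffle_ins p q P Q s = \sum_(m : n.-tuple bool | count id m == q)
    (-1) ^+ inversions m *: P (Q (mask m s) :: mask (map negb m) s).
Proof. by move=> <-. Qed.

Lemma count_negb (m : seq bool) : count id (map negb m) = (size m - count id m)%N.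
Proof.
rewrite count_map -(count_predC id) addKn; exact: eq_count.
Qed.

Lemma unshuffle_multilinear : multilinear_insertion (@unshuffle_ins K A).
Proof.
split.
- move=> p q p' q' P Q s cP cQ pqs ne; rewrite /unshuffle_ins big1 // => m /eqP mq.
  have [qq'|/eqP qq'] := eqVneq q' q; last first.
    rewrite (cochain_size cQ) ?size_mask ?size_tuple ?mq //.
    by rewrite (cochain_entry0 [::] _ cP) scaler0.
  have qs : (q' <= size s)%N by rewrite -mq -{2}(size_tuple m) count_size.
  rewrite (cochain_size cP) ?scaler0 //= size_mask ?size_map ?size_tuple //.
  rewrite count_negb size_tuple mq => E; apply: ne; rewrite qq'; congr (_, _); lia.
- move=> p q c P P' Q s; rewrite /unshuffle_ins scaler_sumr -big_split.
  by apply: eq_bigr => m _; rewrite /= !fctE scalerDr !scalerA mulrC.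
- move=> r p q c P Q Q' s cP; rewrite /unshuffle_ins scaler_sumr -big_split.
  apply: eq_bigr => m _; rewrite /= !fctE.
  by rewrite (cP.2 [::]) scalerDr !scalerA mulrC.
- move=> p q P Q cP cQ; split=> [s sn|s1 s2 c f g].
    rewrite /unshuffle_ins big1 // => m /eqP mq.
    have qs : (q <= size s)%N by rewrite -mq -{2}(size_tuple m) count_size.
    rewrite (cochain_size cP) ?scaler0 //= size_mask ?size_map ?size_tuple //.
    rewrite count_negb size_tuple mq; lia.
  have sz x : size (s1 ++ x :: s2) = (size s1 + (size s2).+1)%N by rewrite size_cat.
  rewrite !(unshuffle_insE _ _ _ _ (sz _)) scaler_sumr -big_split.
  apply: eq_bigr => m _ /=.
  rewrite scalerA mulrC -scalerA -scalerDr; congr (_ *: _).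
  have szm := size_tuple m; rewrite -(cat_take_drop (size s1) m).
  set m1 := take _ _; have szm1 : size m1 = size s1 by rewrite size_takel ?szm ?leq_addr.
  have : size (drop (size s1) m) = (size s2).+1 by rewrite size_drop szm addKn.
  case: (drop _ _) => // b m2 _.
  rewrite !map_cat !mask_cat ?size_map //=; case: b => /=.
    by rewrite cQ.2 (cP.2 [::]).
  by rewrite -!cat_cons cP.2.
Qed.
End Unshuffle.

Lemma eq_cochain (K : fieldType) (A : lmodType K) p (P Q : seq A -> A) :
  is_cochain p P -> is_cochain p Q -> (forall s, size s = p -> P s = Q s) -> P = Q.
Proof.
move=> cP cQ PQ; apply/funext => s; have [/PQ //|/eqP sp] := eqVneq (size s) p.
by rewrite (cochain_size cP) // (cochain_size cQ).
Qed.

Section Shifted.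
Context {K : fieldType} {A : lmodType K}.
Local Notation cochain := (seq A -> A).
Variable C : nat -> set cochain.

(** Below degree -1 only 0 is homogeneous. *)
Lemma shiftedP k a : shifted C k a ->
  (exists2 p : nat, k = p%:Z - 1 & C p a) \/ (k < -1 /\ a = 0).
Proof.
rewrite /shifted; case E : (k + 1) => [p|p] Ca; [left; exists p => //|right; split=> //].
  by rewrite -E addrK.
lia.
Qed.

Lemma shifted_nat p a k : C p a -> k = p%:Z - 1 -> shifted C k a.
Proof. by move=> Ca ->; rewrite /shifted subrK. Qed.

Hypothesis C0 : forall p, C p 0.

Lemma shifted0 k : shifted C k 0.
Proof. by rewrite /shifted; case: (k + 1). Qed.

End Shifted.

Section LowerInsertion.
Context {K : fieldType} {A : lmodType K}.
Local Notation cochain := (seq A -> A).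
Variables (ins : nat -> nat -> cochain -> cochain -> cochain).
Variables (C : nat -> set cochain) (d : cochain -> cochain).
Local Notation br := (insertion_bracket ins).
Hypothesis insP : multilinear_insertion ins.
Hypothesis C_cochain : forall p P, C p P -> is_cochain p P.
Hypothesis C0 : forall p, C p 0.
Hypothesis CL : forall p c P Q, C p P -> C p Q -> C p (c *: P + Q).
Hypothesis dL : forall c P Q, d (c *: P + Q) = c *: d P + d Q.
Hypothesis dC : forall p P, C p P -> C p.+1 (d P).
Hypothesis d_fun : forall f, C 0 f -> d f = 0.
Hypothesis br22 : forall P Q, C 2 P -> C 2 Q -> C 3 (br P Q).
Hypothesis br20 : forall P f, C 2 P -> C 0 f -> C 1 (br P f).
Hypothesis br10 : forall P f, C 1 P -> C 0 f -> C 0 (br P f).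
Hypothesis derived20 : forall P f g, C 2 P -> C 0 f -> C 0 g ->
  br f (br P g) = - br g (br P f).
Hypothesis jacobi220 : forall P Q f, C 2 P -> C 2 Q -> C 0 f ->
  br P (br Q f) + br Q (br P f) = br (br P Q) f.
Hypothesis d_br20 : forall P f, C 2 P -> C 0 f -> d (br P f) = br (d P) f.

(** It remains to check low arities: a cochain of arity p has degree p - 1, so
    functions are the cochains of arity 0. *)
Lemma lower_insertion : lower_dgla (@Dgla K cochain (shifted C) d br).
Proof.
have d0 : d 0 = 0.
  by have := dL 1 0 0; rewrite !scale1r addr0 -[X in X = _]addr0 => /addrI.
split=> /=.
- exact: shifted0.
- move=> k c a b; rewrite /shifted; case: (k + 1) => p; first exact: CL.
  by move=> -> ->; rewrite scaler0 addr0.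
- by move=> k a kN /shiftedP[[p kE]|[]//]; move: kN; rewrite kE; lia.
- exact: dL.
- move=> k a /shiftedP[[p -> Ca]|[_ ->]]; last by rewrite d0; exact: shifted0.
  by apply: (shifted_nat (dC Ca)); lia.
- exact: d_fun.
- move=> k c a b b' /shiftedP[[p _ /C_cochain Ca]|[_ ->]].
    exact: (insertion_bracketR insP _ _ _ Ca).
  exact: (insertion_bracketR insP _ _ _ (is_cochain0 0)).
- move=> j k a b /shiftedP[[p -> /C_cochain Ca]|[_ ->]]; last first.
    move=> /shiftedP[[q _ /C_cochain Cb]|[_ ->]].
      rewrite (insertion_bracket0 insP Cb) scaler0.
      rewrite (insertion_bracket_anti insP (is_cochain0 0) Cb).
      by rewrite (insertion_bracket0 insP Cb) scaler0.
    by rewrite (insertion_bracket0 insP (is_cochain0 0)) scaler0.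
  move=> /shiftedP[[q -> /C_cochain Cb]|[_ ->]].
    rewrite (insertion_bracket_anti insP Ca Cb); congr (- _ *: _).
    rewrite -signr_odd -[RHS]signr_odd !oddM.
    have odd_pred (r : nat) : odd `|r%:Z - 1| = odd r.+1 by case: r => // r; rewrite /= negbK; congr odd; lia.
    by rewrite !odd_pred.
  rewrite (insertion_bracket0 insP Ca) (insertion_bracket_anti insP (is_cochain0 0) Ca).
  by rewrite (insertion_bracket0 insP Ca) !scaler0.
- exact: br22.
- exact: br20.
- exact: br10.
- exact: derived20.
- exact: jacobi220.
- exact: d_br20.
Qed.

End LowerInsertion.

Section ExplicitGerstenhaber.
Context {K : fieldType} {A : lmodType K}.
Local Notation cochain := (seq A -> A).
Implicit Types P Q f : cochain.

Lemma gerstenhaber_ins0 q P Q s : gerstenhaber_ins 0 q P Q s = 0.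
Proof. by rewrite /gerstenhaber_ins big_ord0. Qed.

Lemma gerstenhaber_ins10 P f : gerstenhaber_ins 1 0 P f [::] = P [:: f [::]].
Proof. by rewrite /gerstenhaber_ins big_ord1 /= expr0 scale1r. Qed.

Lemma gerstenhaber_ins20 P f a :
  gerstenhaber_ins 2 0 P f [:: a] = P [:: f [::]; a] - P [:: a; f [::]].
Proof.
rewrite /gerstenhaber_ins !big_ord_recl big_ord0 /= addr0 expr0 scale1r.
by rewrite expr1 scaleN1r.
Qed.

Lemma gerstenhaber_ins12 P Q a b : gerstenhaber_ins 1 2 P Q [:: a; b] = P [:: Q [:: a; b]].
Proof. by rewrite /gerstenhaber_ins big_ord1 /= expr0 scale1r. Qed.

Lemma gerstenhaber_ins21 P Q a b : gerstenhaber_ins 2 1 P Q [:: a; b] =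
  P [:: Q [:: a]; b] + P [:: a; Q [:: b]].
Proof.
rewrite /gerstenhaber_ins !big_ord_recl big_ord0 /= addr0 expr0 scale1r.
by rewrite mul1n sqrrN expr1n scale1r.
Qed.

Lemma gerstenhaber_ins22 P Q a b c : gerstenhaber_ins 2 2 P Q [:: a; b; c] =
  P [:: Q [:: a; b]; c] - P [:: a; Q [:: b; c]].
Proof.
rewrite /gerstenhaber_ins !big_ord_recl big_ord0 /= addr0 expr0 scale1r.
by rewrite mul1n !exprS expr0 mulr1 mulrNN mulr1 mulr1 scaleN1r.
Qed.

Lemma gerstenhaber_ins30 P f a b : gerstenhaber_ins 3 0 P f [:: a; b] =
  P [:: f [::]; a; b] - P [:: a; f [::]; b] + P [:: a; b; f [::]].
Proof.
rewrite /gerstenhaber_ins !big_ord_recl big_ord0 /= addr0 expr0 scale1r.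
by rewrite addrA /bump /= !mul1n !muln1 expr1 scaleN1r sqrrN expr1n scale1r.
Qed.

End ExplicitGerstenhaber.

Section ExplicitUnshuffle.
Context {K : fieldType} {A : lmodType K}.
Local Notation cochain := (seq A -> A).
Implicit Types P Q f : cochain.

Lemma big_tupleS (V : nmodType) n (P : pred (seq bool)) (F : seq bool -> V) :
  \sum_(m : n.+1.-tuple bool | P m) F m =
  \sum_(m : n.-tuple bool | P (true :: m)) F (true :: m) +
  \sum_(m : n.-tuple bool | P (false :: m)) F (false :: m).
Proof.
pose h (u : bool * n.-tuple bool) : n.+1.-tuple bool := [tuple of u.1 :: u.2].
rewrite (reindex h); last first.
  exists (fun m : n.+1.-tuple bool => (thead m, [tuple of behead m])).
    by move=> [b m] _; congr (_, _); apply: val_inj.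
  by move=> m _; rewrite /h /= -tuple_eta.
rewrite big_mkcond -(pair_big xpredT xpredT (fun b (m : n.-tuple bool) =>
  if P (b :: m) then F (b :: m) else 0)) /=.
by rewrite big_bool /= -!big_mkcond.
Qed.

Lemma big_tuple0 (V : nmodType) (P : pred (seq bool)) (F : seq bool -> V) :
  \sum_(m : 0.-tuple bool | P m) F m = if P [::] then F [::] else 0.
Proof.
rewrite big_mkcond (big_pred1 [tuple]) //= => m.
by apply/esym/eqP; exact: tuple0.
Qed.

(** The Boolean tuples of length n as an explicit list, on which the unshuffle
    sums in low arity can be computed. *)
Fixpoint masks n : seq (seq bool) :=
  if n is n'.+1 then map (cons true) (masks n') ++ map (cons false) (masks n')
  else [:: [::]].

Lemma big_masks (V : nmodType) n (P : pred (seq bool)) (F : seq bool -> V) :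
  \sum_(m : n.-tuple bool | P m) F m = \sum_(m <- masks n | P m) F m.
Proof.
elim: n P F => [|n IH] P F /=; first by rewrite big_tuple0 big_cons big_nil addr0.
by rewrite big_tupleS big_cat !big_map -!IH.
Qed.

Lemma unshuffle_masks p q P Q s :
  unshuffle_ins p q P Q s = \sum_(m <- masks (size s) | count id m == q)
    (-1) ^+ inversions m *: P (Q (mask m s) :: mask (map negb m) s).
Proof.
exact: (big_masks _ (fun m => count id m == q) (fun m => (-1) ^+ inversions m *:
  P (Q (mask m s) :: mask (map negb m) s))).
Qed.

Lemma inversions_cons b m :
  inversions (b :: m) = (~~ b * count id m + inversions m)%N.
Proof.
rewrite /inversions big_mkcond big_ord_recl /= if_same add0n.
rewrite -big_mkcond /= big_split /=; congr (_ + _)%N.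
rewrite -sum1_count (big_nth false) big_mkord big_distrr /=.
by apply: eq_bigr => i _; rewrite muln1.
Qed.

Lemma inversions_nil : inversions [::] = 0%N.
Proof. by rewrite /inversions big_ord0. Qed.

Let unshE := (unshuffle_masks, inversions_cons, inversions_nil).

Lemma unshuffle_ins0 q P Q s : (size s < q)%N -> unshuffle_ins 0 q P Q s = 0.
Proof.
move=> sq; rewrite /unshuffle_ins big1 // => m /eqP E.
by have := count_size id m; rewrite E size_tuple leqNgt sq.
Qed.

Lemma unshuffle_ins10 P f : unshuffle_ins 1 0 P f [::] = P [:: f [::]].
Proof. by rewrite unshuffle_masks /= !big_cons big_nil /= addr0 unshE expr0 scale1r. Qed.

Lemma unshuffle_ins20 P f a : unshuffle_ins 2 0 P f [:: a] = P [:: f [::]; a].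
Proof.
by rewrite unshuffle_masks /= !big_cons big_nil /= addr0 !unshE /= expr0 scale1r.
Qed.

Lemma unshuffle_ins12 P Q a b : unshuffle_ins 1 2 P Q [:: a; b] = P [:: Q [:: a; b]].
Proof.
by rewrite unshuffle_masks /= !big_cons big_nil /= addr0 !unshE /= expr0 scale1r.
Qed.

Lemma unshuffle_ins21 P Q a b : unshuffle_ins 2 1 P Q [:: a; b] =
  P [:: Q [:: a]; b] - P [:: Q [:: b]; a].
Proof.
rewrite unshuffle_masks /= !big_cons big_nil /= addr0 !inversions_cons inversions_nil /=.
by rewrite expr0 scale1r expr1 scaleN1r.
Qed.

Lemma unshuffle_ins22 P Q a b c : unshuffle_ins 2 2 P Q [:: a; b; c] =
  P [:: Q [:: a; b]; c] - P [:: Q [:: a; c]; b] + P [:: Q [:: b; c]; a].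
Proof.
rewrite unshuffle_masks /= !big_cons big_nil /= addr0 !inversions_cons inversions_nil /=.
by rewrite expr0 scale1r expr1 scaleN1r sqrrN expr1n scale1r addrA.
Qed.

Lemma unshuffle_ins30 P f a b : unshuffle_ins 3 0 P f [:: a; b] = P [:: f [::]; a; b].
Proof.
by rewrite unshuffle_masks /= !big_cons big_nil /= addr0 !unshE /= expr0 scale1r.
Qed.

End ExplicitUnshuffle.

(** * Polyvector fields *)

Section Polyvectors.
Context {R : realType} {n : nat} (M : manifold R n) (k : ground).
Local Notation K := (Defs.scalar R k).
Local Notation A := (smooth_fun M k).
Local Notation cochain := (seq A -> A).
Local Notation pv := (@polyvector R n M k).
Local Notation br := (insertion_bracket (@unshuffle_ins K A)).
Implicit Types (P Q f : cochain) (s : seq A).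
Let insP := @unshuffle_multilinear K A.

Lemma polyvector_cochain p P : pv p P -> is_cochain p P.
Proof. by case. Qed.

Lemma polyvector_skew p P s1 s2 a b : pv p P ->
  P (s1 ++ a :: b :: s2) = - P (s1 ++ b :: a :: s2).
Proof. by case. Qed.

Lemma polyvector_leibniz p P s1 s2 a b : pv p P ->
  P (s1 ++ (a * b) :: s2) = a * P (s1 ++ b :: s2) + b * P (s1 ++ a :: s2).
Proof. by case. Qed.

Lemma polyvector0 p : pv p 0.
Proof.
split; first exact: is_cochain0.
  by move=> s1 s2 a b; rewrite -[LHS]/(0 : A) -[RHS]/(- (0 : A)) oppr0.
by move=> s1 s2 a b; rewrite -[LHS]/(0 : A) -[RHS]/(a * (0 : A) + b * (0 : A)) !mulr0 addr0.
Qed.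

(** Scalars act through constant functions, so that identities mixing scalars
    and products become identities in a commutative ring. *)
Lemma smooth_scale_mul (c : K) : exists u : A, forall a : A, c *: a = u * a.
Proof.
exists (c *: (1 : A)) => a; apply: val_inj; apply/funext => x.
by rewrite -[LHS]/((c : K) * (smooth_val a x : K)) -[RHS]/((c * 1) * (smooth_val a x : K)) mulr1.
Qed.

Lemma polyvectorL p c P Q : pv p P -> pv p Q -> pv p (c *: P + Q).
Proof.
move=> hP hQ; split.
- exact: is_cochainL (polyvector_cochain hP) (polyvector_cochain hQ).
- move=> s1 s2 a b; rewrite !fctE (polyvector_skew _ _ _ _ hP) (polyvector_skew _ _ _ _ hQ).
  by rewrite scalerN opprD.
- move=> s1 s2 a b; rewrite !fctE (polyvector_leibniz _ _ _ _ hP) (polyvector_leibniz _ _ _ _ hQ).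
  by have [u E] := smooth_scale_mul c; rewrite !E; ring.
Qed.

Lemma schouten20 P f a : pv 2 P -> pv 0 f -> br P f [:: a] = P [:: f [::]; a].
Proof.
move=> /polyvector_cochain hP /polyvector_cochain hf.
rewrite (insertion_bracketE insP hP hf) // unshuffle_ins20 unshuffle_ins0 //.
by rewrite scaler0 subr0.
Qed.

Lemma schouten10 P f : pv 1 P -> pv 0 f -> br P f [::] = P [:: f [::]].
Proof.
move=> /polyvector_cochain hP /polyvector_cochain hf.
rewrite (insertion_bracketE insP hP hf) // unshuffle_ins10 unshuffle_ins0 //.
by rewrite scaler0 subr0.
Qed.

Lemma schouten30 P f a b : pv 3 P -> pv 0 f -> br P f [:: a; b] = P [:: f [::]; a; b].
Proof.
move=> /polyvector_cochain hP /polyvector_cochain hf.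
rewrite (insertion_bracketE insP hP hf) // unshuffle_ins30 unshuffle_ins0 //.
by rewrite scaler0 subr0.
Qed.

Lemma schouten21 P Q a b : pv 2 P -> pv 1 Q -> br P Q [:: a; b] =
  P [:: Q [:: a]; b] - P [:: Q [:: b]; a] - Q [:: P [:: a; b]].
Proof.
move=> /polyvector_cochain hP /polyvector_cochain hQ.
rewrite (insertion_bracketE insP hP hQ) // unshuffle_ins21 unshuffle_ins12.
by rewrite -signr_odd expr0 scale1r.
Qed.

Lemma schouten22 P Q a b c : pv 2 P -> pv 2 Q -> br P Q [:: a; b; c] =
  P [:: Q [:: a; b]; c] - P [:: Q [:: a; c]; b] + P [:: Q [:: b; c]; a] +
  (Q [:: P [:: a; b]; c] - Q [:: P [:: a; c]; b] + Q [:: P [:: b; c]; a]).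
Proof.
move=> /polyvector_cochain hP /polyvector_cochain hQ.
rewrite (insertion_bracketE insP hP hQ) // !unshuffle_ins22.
by rewrite -signr_odd expr1 scaleN1r opprK.
Qed.

Lemma polyvector_br20 P f : pv 2 P -> pv 0 f -> pv 1 (br P f).
Proof.
move=> hP hf.
have cB : is_cochain 1 (br P f).
  exact: (insertion_bracket_cochain insP (polyvector_cochain hP) (polyvector_cochain hf)).
split=> // s1 s2 a b.
  by rewrite !(cochain_size cB) ?oppr0 // size_cat /=; lia.
case: s1 s2 => [|x s1] [|y s2] /=; first by rewrite !schouten20 // (polyvector_leibniz [:: f [::]] [::] a b hP).
- by rewrite !(cochain_size cB) // !mulr0 addr0.
- by rewrite !(cochain_size cB) ?mulr0 ?addr0 //= size_cat /=; lia.
- by rewrite !(cochain_size cB) ?mulr0 ?addr0 //= size_cat /=; lia.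
Qed.

Lemma polyvector_br10 P f : pv 1 P -> pv 0 f -> pv 0 (br P f).
Proof.
move=> hP hf.
have cB : is_cochain 0 (br P f).
  exact: (insertion_bracket_cochain insP (polyvector_cochain hP) (polyvector_cochain hf)).
split=> // s1 s2 a b.
  by rewrite !(cochain_size cB) ?oppr0 // size_cat /=; lia.
by rewrite !(cochain_size cB) ?mulr0 ?addr0 //= size_cat /=; lia.
Qed.

(** In the Leibniz rule the products of a value of P and a value of Q, which each
    insertion produces separately, cancel between the two insertions by skew
    symmetry.  The rule in the first entry gives the other two by transpositions. *)
Lemma polyvector_br22 P Q : pv 2 P -> pv 2 Q -> pv 3 (br P Q).
Proof.
move=> hP hQ.
have cB : is_cochain 3 (br P Q).
  exact: (insertion_bracket_cochain insP (polyvector_cochain hP) (polyvector_cochain hQ)).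
have sP x y : P [:: x; y] = - P [:: y; x] := polyvector_skew [::] [::] x y hP.
have sQ x y : Q [:: x; y] = - Q [:: y; x] := polyvector_skew [::] [::] x y hQ.
have NP x y : P [:: - x; y] = - P [:: x; y].
  exact: (cochain_entryN [::] [:: y] x (polyvector_cochain hP)).
have NQ x y : Q [:: - x; y] = - Q [:: x; y].
  exact: (cochain_entryN [::] [:: y] x (polyvector_cochain hQ)).
have DP x x' y : P [:: x + x'; y] = P [:: x; y] + P [:: x'; y].
  exact: (cochain_entryD [::] [:: y] _ _ (polyvector_cochain hP)).
have DQ x x' y : Q [:: x + x'; y] = Q [:: x; y] + Q [:: x'; y].
  exact: (cochain_entryD [::] [:: y] _ _ (polyvector_cochain hQ)).
have swap01 a b c : br P Q [:: a; b; c] = - br P Q [:: b; a; c].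
  by rewrite !schouten22 // (sQ b a) (sP b a) NP NQ; ring.
have swap12 a b c : br P Q [:: a; b; c] = - br P Q [:: a; c; b].
  by rewrite !schouten22 // (sQ c b) (sP c b) NP NQ; ring.
have LP0 a b y : P [:: a * b; y] = a * P [:: b; y] + b * P [:: a; y].
  exact: (polyvector_leibniz [::] [:: y] a b hP).
have LQ0 a b y : Q [:: a * b; y] = a * Q [:: b; y] + b * Q [:: a; y].
  exact: (polyvector_leibniz [::] [:: y] a b hQ).
have leib a b x y : br P Q [:: a * b; x; y] = a * br P Q [:: b; x; y] + b * br P Q [:: a; x; y].
  rewrite !schouten22 // !(sP _ (a * b)) !(sQ _ (a * b)) !LP0 !LQ0 !DP !DQ !LP0 !LQ0.
  rewrite (sP _ a) (sP _ b) (sQ _ a) (sQ _ b).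
  ring.
split=> // s1 s2 a b.
  have [|/eqP sz] := eqVneq (size (s1 ++ a :: b :: s2)) 3; last first.
    by rewrite !(cochain_size cB) ?oppr0 //; move: sz; rewrite !size_cat.
  by case: s1 s2 => [|x [|y s1]] [|z [|t s2]] //=; rewrite ?size_cat /=; lia.
have [|/eqP sz] := eqVneq (size (s1 ++ a * b :: s2)) 3; last first.
  by rewrite !(cochain_size cB) ?mulr0 ?addr0 //; move: sz; rewrite !size_cat.
case: s1 s2 => [|x [|y [|z s1]]] [|u [|v [|w s2]]] //=; rewrite ?size_cat /=; try lia.
- by move=> _; rewrite !(swap01 x) leib !mulrN opprD.
- by move=> _; rewrite !(swap12 x y) !(swap01 x) !opprK leib.
Qed.

(** Both sides are values of P on the two functions, in either order. *)
Lemma polyvector_derived20 P f g : pv 2 P -> pv 0 f -> pv 0 g ->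
  br f (br P g) = - br g (br P f).
Proof.
move=> hP hf hg; have hPf := polyvector_br20 hP hf; have hPg := polyvector_br20 hP hg.
have cf := polyvector_cochain hf; have cg := polyvector_cochain hg.
rewrite (insertion_bracket_anti insP cf (polyvector_cochain hPg)).
rewrite (insertion_bracket_anti insP cg (polyvector_cochain hPf)).
rewrite sqrrN expr1n !scaleN1r opprK.
have cl := polyvector_cochain (polyvector_br10 hPg hf).
have cr := polyvector_cochain (polyvector_br10 hPf hg).
rewrite -scaleN1r -[X in X = _]addr0.
apply: eq_cochain (is_cochainL _ cl (is_cochain0 _)) cr _; case=> // _.
rewrite addr0 scaleN1r; apply/esym; rewrite fctE !schouten10 // !schouten20 //.
exact: (polyvector_skew [::] [::] _ _ hP).
Qed.

Lemma polyvector_jacobi220 P Q f : pv 2 P -> pv 2 Q -> pv 0 f ->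
  br P (br Q f) + br Q (br P f) = br (br P Q) f.
Proof.
move=> hP hQ hf; have hPf := polyvector_br20 hP hf; have hQf := polyvector_br20 hQ hf.
have [[cP cQ] cf] := (polyvector_cochain hP, polyvector_cochain hQ, polyvector_cochain hf).
have cPf := polyvector_cochain hPf; have cQf := polyvector_cochain hQf.
apply: (@eq_cochain _ _ 2).
- rewrite -[X in X + _]scale1r; apply: is_cochainL.
    exact: (insertion_bracket_cochain insP cP cQf).
  exact: (insertion_bracket_cochain insP cQ cPf).
- exact: (insertion_bracket_cochain insP (polyvector_cochain (polyvector_br22 hP hQ)) cf).
case=> [|a [|b [|]]] // _; rewrite (schouten30 _ _ (polyvector_br22 hP hQ) hf) fctE !schouten21 //.
rewrite schouten22 // !schouten20 //.
rewrite (polyvector_skew [::] [::] (f [::]) (P _) hQ) (polyvector_skew [::] [::] (f [::]) (Q _) hP).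
ring.
Qed.

Lemma lower_Tpoly : lower_dgla (Tpoly M k).
Proof.
apply: (lower_insertion insP (C := pv)).
- exact: polyvector_cochain.
- exact: polyvector0.
- exact: polyvectorL.
- by move=> c P Q; rewrite scaler0 addr0.
- by move=> p P _; exact: polyvector0.
- by [].
- exact: polyvector_br22.
- exact: polyvector_br20.
- exact: polyvector_br10.
- exact: polyvector_derived20.
- exact: polyvector_jacobi220.
- move=> P f _ /polyvector_cochain cf.
  by rewrite (insertion_bracket_anti insP (is_cochain0 0) cf) (insertion_bracket0 insP cf) scaler0.
Qed.

End Polyvectors.

(** * Local expressions of polydifferential operators *)

Section Calculus.
Context {R : realType} {n : nat}.
Implicit Types (V W : set 'rV[R]_n) (g h : 'rV[R]_n -> R).

Lemma Ck_sub k V W g : W `<=` V -> Ck k V g -> Ck k W g.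
Proof.
move=> WV; elim: k g => [|k IH] g [gc gd].
  by split=> // x Wx; exact: gc (WV _ Wx).
split=> [x Wx|i]; first exact: gc (WV _ Wx).
have [dg dgC] := gd i; split=> [x Wx|]; first exact: dg (WV _ Wx).
exact: IH.
Qed.

Lemma smooth_derivable V g i x : smooth_on V g -> V x -> derivable g x (basis_vec i).
Proof. by move=> /(_ 1%N)[_ /(_ i)[dg _]]; exact: dg. Qed.

Lemma smooth_derive V g i : smooth_on V g -> smooth_on V ('D_(basis_vec i) g).
Proof. by move=> gs m; have [_ /(_ i)[]] := gs m.+1. Qed.

Lemma derive_mul g h x e : derivable g x e -> derivable h x e ->
  'D_e (g * h) x = 'D_e g x * h x + g x * 'D_e h x.
Proof. by move=> dg dh; rewrite (deriveM dg dh) addrC [in RHS]mulrC. Qed.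

Lemma derive_mulB (a b c d : 'rV[R]_n -> R) x e : derivable a x e -> derivable b x e ->
  derivable c x e -> derivable d x e ->
  'D_e (a * b - c * d) x =
  'D_e a x * b x + a x * 'D_e b x - ('D_e c x * d x + c x * 'D_e d x).
Proof.
move=> da db dc dd; rewrite (deriveB (derivableM da db) (derivableM dc dd)).
by rewrite (derive_mul da db) (derive_mul dc dd).
Qed.

Lemma derive_mulD (a b c d : 'rV[R]_n -> R) x e : derivable a x e -> derivable b x e ->
  derivable c x e -> derivable d x e ->
  'D_e (a * b + c * d) x =
  'D_e a x * b x + a x * 'D_e b x + ('D_e c x * d x + c x * 'D_e d x).
Proof.
move=> da db dc dd; rewrite (deriveD (derivableM da db) (derivableM dc dd)).
by rewrite (derive_mul da db) (derive_mul dc dd).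
Qed.

Variable k : ground.
Local Notation K := (Defs.scalar R k).
Implicit Types u v : 'rV[R]_n -> K.

Lemma ksmooth_sub V W u : W `<=` V -> ksmooth_on V u -> ksmooth_on W u.
Proof. by move=> WV [us us']; split=> m; [exact: Ck_sub (us m)|exact: Ck_sub (us' m)]. Qed.

Lemma ksmooth_pderiv V u i : ksmooth_on V u -> ksmooth_on V (pderiv i u).
Proof.
rewrite /ksmooth_on /pderiv; case: k u => u [us us']; split.
- exact: smooth_derive us.
- by move=> m; exact: Ck_cst.
- exact: smooth_derive us.
- exact: smooth_derive us'.
Qed.

Lemma ksmooth_pderivs V u w : ksmooth_on V u -> ksmooth_on V (pderivs w u).
Proof. by move=> us; elim: w => //= i w; exact: ksmooth_pderiv. Qed.

Lemma eq_pderiv V u v i x : open V -> V x -> (forall y, V y -> u y = v y) ->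
  pderiv i u x = pderiv i v x.
Proof.
move=> oV Vx uv; rewrite /pderiv.
have near_uv (f : K -> R) : \forall y \near x, (f \o u) y = (f \o v) y.
  by apply: filterS (open_nbhs_nbhs (conj oV Vx)) => y Vy /=; rewrite uv.
by congr mk_scalar; apply: near_eq_derive => //; exact: near_uv.
Qed.

Lemma eq_ksmooth V u v : open V -> (forall y, V y -> u y = v y) ->
  ksmooth_on V u -> ksmooth_on V v.
Proof.
by move=> oV uv [us us']; split=> m; [apply: eq_Ck (us m)|apply: eq_Ck (us' m)] => // y Vy;
  rewrite /= uv.
Qed.

Lemma pderiv_cst c i x : pderiv i (cst c : 'rV[R]_n -> K) x = 0.
Proof.
rewrite /pderiv; case: k c => c /=.
  by rewrite (derive_cst c).
by rewrite (derive_cst (complex.Re c)) (derive_cst (complex.Im c)).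
Qed.

Lemma pderivD V u v i x : ksmooth_on V u -> ksmooth_on V v -> V x ->
  pderiv i (u + v) x = pderiv i u x + pderiv i v x.
Proof.
rewrite /ksmooth_on /pderiv; case: k u v => u v [us us'] [vs vs'] Vx /=.
  by rewrite -deriveD //; exact: smooth_derivable Vx.
have -> : (@complex.Re R) \o (u + v) = (@complex.Re R \o u) + (@complex.Re R \o v).
  by apply/funext => y; rewrite !fctE /=; case: (u y) (v y) => ? ? [].
have -> : (@complex.Im R) \o (u + v) = (@complex.Im R \o u) + (@complex.Im R \o v).
  by apply/funext => y; rewrite !fctE /=; case: (u y) (v y) => ? ? [].
by rewrite !deriveD //; exact: smooth_derivable Vx.
Qed.

(** For complex values this is the Leibniz rule of the real and imaginary parts. *)
Lemma pderivM V u v i x : ksmooth_on V u -> ksmooth_on V v -> V x ->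
  pderiv i (u * v) x = pderiv i u x * v x + u x * pderiv i v x.
Proof.
rewrite /ksmooth_on /pderiv; case: k u v => u v [us us'] [vs vs'] Vx /=.
  have du := smooth_derivable (i := i) us Vx; have dv := smooth_derivable (i := i) vs Vx.
  exact: derive_mul.
have du := smooth_derivable (i := i) us Vx; have dv := smooth_derivable (i := i) vs Vx.
have du' := smooth_derivable (i := i) us' Vx; have dv' := smooth_derivable (i := i) vs' Vx.
have -> : (@complex.Re R) \o (u * v) = (@complex.Re R \o u) * (@complex.Re R \o v) -
    (@complex.Im R \o u) * (@complex.Im R \o v).
  by apply/funext => y; rewrite !fctE /=; case: (u y) (v y) => ? ? [].
have -> : (@complex.Im R) \o (u * v) = (@complex.Re R \o u) * (@complex.Im R \o v) +
    (@complex.Im R \o u) * (@complex.Re R \o v).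
  by apply/funext => y; rewrite !fctE /=; case: (u y) (v y) => ? ? [] ? ? /=; ring.
rewrite (derive_mulB du dv du' dv') (derive_mulD du dv' du' dv) /=.
case: (u x) (v x) => [p q] [r s] /=.
move: ('D_(basis_vec i) (@complex.Re R \o u) x) ('D_(basis_vec i) (@complex.Im R \o u) x).
move: ('D_(basis_vec i) (@complex.Re R \o v) x) ('D_(basis_vec i) (@complex.Im R \o v) x).
move=> a b c d; apply/eqP; rewrite eq_complex /=.
by apply/andP; split; apply/eqP; ring.
Qed.

End Calculus.

Section DifferentialOperators.
Context {R : realType} {n : nat} (M : manifold R n) (k : ground).
Local Notation K := (Defs.scalar R k).
Local Notation A := (smooth_fun M k).
Variable c : chart R n M.
Implicit Types (V W : set 'rV[R]_n) (F G : seq A -> 'rV[R]_n -> K).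
Local Notation term := (@polydiff_term R n k).

Definition good_term V p (t : term) : Prop := ksmooth_on V t.1 /\ size t.2 = p.

(** F is given on V by a finite sum of terms of arity p.  The inductive form
    avoids indexing the list of terms; [difopP] relates the two. *)
Inductive difop V p : (seq A -> 'rV[R]_n -> K) -> Prop :=
| difop_nil F : (forall s y, size s = p -> V y -> F s y = 0) -> difop V p F
| difop_cons t F G : good_term V p t -> difop V p G ->
    (forall s y, size s = p -> V y -> F s y = eval_term c t s y + G s y) ->
    difop V p F.

Lemma difopP V p F : difop V p F <-> exists2 ts : seq term,
  (forall j, (j < size ts)%N -> good_term V p (nth (0, [::]) ts j)) &
  (forall s y, size s = p -> V y -> F s y = \sum_(t <- ts) eval_term c t s y).
Proof.
split=> [|[ts]].
  elim=> {F} [F F0|t F G gt _ [ts gts GE] FE].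
    by exists [::] => // s y sp Vy; rewrite big_nil F0.
  exists (t :: ts) => [[|j]|s y sp Vy] //=; first exact: gts.
  by rewrite big_cons FE // GE.
elim: ts F => [|t ts IH] F gts FE.
  by apply: difop_nil => s y sp Vy; rewrite FE // big_nil.
apply: (difop_cons (gts 0%N isT) (IH (fun s y => \sum_(t <- ts) eval_term c t s y) _ _)) => //.
  by move=> j; exact: (gts j.+1).
by move=> s y sp Vy; rewrite FE // big_cons.
Qed.

Lemma eq_difop V p F G : difop V p F ->
  (forall s y, size s = p -> V y -> G s y = F s y) -> difop V p G.
Proof.
case=> {F} [F F0|t F H gt dH FE] GF.
  by apply: difop_nil => s y sp Vy; rewrite GF // F0.
by apply: (difop_cons gt dH) => s y sp Vy; rewrite GF // FE.
Qed.

Lemma difop_sub V W p F : W `<=` V -> difop V p F -> difop W p F.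
Proof.
move=> WV; elim=> {F} [F F0|t F H [st tp] _ dH FE].
  by apply: difop_nil => s y sp Wy; rewrite F0 //; exact: WV.
apply: (@difop_cons _ _ t _ _ _ dH) => [|s y sp Wy].
  by split=> //; exact: ksmooth_sub WV st.
by rewrite FE //; exact: WV.
Qed.

Lemma difop0 V p : difop V p (fun _ _ => 0).
Proof. exact: difop_nil. Qed.

Lemma difop_term V p (t : term) : good_term V p t -> difop V p (eval_term c t).
Proof. by move=> gt; apply: (difop_cons gt (difop0 V p)) => s y _ _; rewrite addr0. Qed.

Lemma difopD V p F G : difop V p F -> difop V p G ->
  difop V p (fun s y => F s y + G s y).
Proof.
move=> dF dG; elim: dF => {F} [F F0|t F H gt _ dH FE].
  by apply: (eq_difop dG) => s y sp Vy; rewrite F0 // add0r.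
by apply: (difop_cons gt dH) => s y sp Vy; rewrite FE // addrA.
Qed.

Lemma difop_sum V p (I : Type) (r : seq I) (H : I -> seq A -> 'rV[R]_n -> K) :
  (forall i, difop V p (H i)) -> difop V p (fun s y => \sum_(i <- r) H i s y).
Proof.
move=> dH; elim: r => [|i r IH]; first by apply: difop_nil => s y _ _; rewrite big_nil.
by apply: eq_difop (difopD (dH i) IH) _ => s y _ _; rewrite big_cons.
Qed.

Lemma eval_term_cat (t t' : term) s y p : size t.2 = p -> (p <= size s)%N ->
  eval_term c (t.1 * t'.1, t.2 ++ t'.2) s y =
  eval_term c t (take p s) y * eval_term c t' (drop p s) y.
Proof.
move=> tp ps; rewrite /eval_term /= !fctE -{1}(cat_take_drop p s).
by rewrite zip_cat ?size_takel // big_cat /= mulrACA.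
Qed.

(** Products in disjoint sets of arguments: the words of multi-indices are
    concatenated. *)
Lemma difop_mul V p q F G : open V -> difop V p F -> difop V q G ->
  difop V (p + q) (fun s y => F (take p s) y * G (drop p s) y).
Proof.
move=> oV dF dG; have sz (s : seq A) : size s = (p + q)%N ->
    size (take p s) = p /\ size (drop p s) = q.
  by move=> spq; rewrite size_take_min size_drop spq addKn (minn_idPl (leq_addr _ _)).
elim: dF => {F} [F F0|t F H [st tp] _ dH FE].
  by apply: difop_nil => s y /sz[sp _] Vy; rewrite F0 // mul0r.
apply: (@eq_difop _ _ (fun s y => eval_term c t (take p s) y * G (drop p s) y +
    H (take p s) y * G (drop p s) y)); last first.
  by move=> s y /sz[sp _] Vy; rewrite FE // mulrDl.
apply: difopD => // {H dH FE}.
elim: dG => {G} [G G0|t' G H [st' tq] _ dH GE].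
  by apply: difop_nil => s y /sz[_ sq] Vy; rewrite G0 // mulr0.
apply: (@difop_cons _ _ (t.1 * t'.1, t.2 ++ t'.2) _ _ _ dH).
  by split; [exact: ksmoothM|rewrite size_cat tp tq].
move=> s y spq Vy; have [sp sq] := sz _ spq.
by rewrite GE // mulrDr (eval_term_cat _ _ tp) // spq leq_addr.
Qed.

Lemma difop_scale V p (a : 'rV[R]_n -> K) F : open V -> ksmooth_on V a -> difop V p F ->
  difop V p (fun s y => a y * F s y).
Proof.
move=> oV sa dF.
have da : difop V 0 (fun _ y => a y).
  have gt : good_term V 0 (a, [::]) by [].
  apply: eq_difop (difop_term gt) _ => -[|//] y _ _.
  by rewrite /eval_term big_nil mulr1.
by apply: eq_difop (difop_mul oV da dF) _ => s y _ _; rewrite drop0.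
Qed.

Section OnChart.
Hypothesis ac : atlas c.
Variable V : set 'rV[R]_n.
Hypotheses (oV : open V) (Vc : V `<=` img c).

Lemma ksmooth_smooth_fun (f : A) : ksmooth_on V ((f : M -> K) \o psi c).
Proof.
apply: (ksmooth_sub Vc).
by have /asboolP := smooth_valP f; exact.
Qed.

Lemma difop_pderivs w : difop V 1 (fun s y => pderivs w ((head 0 s : M -> K) \o psi c) y).
Proof.
have gt : good_term V 1 (cst 1, [:: w]) by split=> //; exact: ksmooth_cst.
apply: eq_difop (difop_term gt) _ => -[|f [|]] // y _ _.
by rewrite /eval_term /= mul1r big_cons big_nil mulr1.
Qed.

Lemma difop_word ws :
  difop V (size ws) (fun s y => \prod_(wf <- zip ws s) pderivs wf.1 ((wf.2 : M -> K) \o psi c) y).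
Proof.
have gt : good_term V (size ws) (cst 1, ws) by split=> //; exact: ksmooth_cst.
by apply: eq_difop (difop_term gt) _ => s y _ _; rewrite /eval_term mul1r.
Qed.

Lemma ksmooth_word ws (s : seq A) :
  ksmooth_on V (fun y => \prod_(wf <- zip ws s) pderivs wf.1 ((wf.2 : M -> K) \o psi c) y).
Proof.
elim: ws s => [|w ws IH] s.
  apply: eq_ksmooth (ksmooth_cst V 1) => // y _.
  by case: s => [|f s]; rewrite /= big_nil.
case: s => [|f s].
  by apply: eq_ksmooth (ksmooth_cst V 1) => // y _; rewrite /= big_nil.
have sw := ksmooth_pderivs w (ksmooth_smooth_fun f).
apply: eq_ksmooth (ksmoothM oV sw (IH s)) => // y _.
by rewrite /= big_cons.
Qed.

Lemma ksmooth_difop p F s : difop V p F -> size s = p -> ksmooth_on V (F s).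
Proof.
move=> + sp; elim=> {F} [F F0|t F G [st _] _ sG FE].
  by apply: eq_ksmooth (ksmooth_cst V 0) => // y Vy; rewrite F0.
apply: eq_ksmooth (ksmoothD oV (ksmoothM oV st (ksmooth_word t.2 s)) sG) => // y Vy.
by rewrite FE.
Qed.

Lemma difop_pderiv_word i ws : difop V (size ws) (fun s =>
  pderiv i (fun y => \prod_(wf <- zip ws s) pderivs wf.1 ((wf.2 : M -> K) \o psi c) y)).
Proof.
elim: ws => [|w ws IH].
  apply: difop_nil => s y _ Vy; rewrite -(pderiv_cst (1 : K) i y).
  by apply: (eq_pderiv _ oV Vy) => z _; case: s => [|f s]; rewrite /= big_nil.
have d1 := difop_mul oV (difop_pderivs (i :: w)) (difop_word ws).
have d2 := difop_mul oV (difop_pderivs w) IH.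
apply: eq_difop (difopD d1 d2) _ => -[|f s] // y [sp] Vy.
have sw := ksmooth_pderivs w (ksmooth_smooth_fun f).
rewrite /= drop0 -(pderivM _ sw (ksmooth_word ws s) Vy).
by apply: (eq_pderiv _ oV Vy) => z _; rewrite big_cons.
Qed.

(** A derivative falls either on the coefficient or on one of the arguments. *)
Lemma difop_pderiv p i F : difop V p F -> difop V p (fun s => pderiv i (F s)).
Proof.
elim=> {F} [F F0|t F G [st tp] dG dG' FE].
  apply: difop_nil => s y sp Vy; rewrite -(pderiv_cst (0 : K) i y).
  by apply: (eq_pderiv _ oV Vy) => z Vz; exact: F0.
have dw := difop_word t.2; have dw' := difop_pderiv_word i t.2; rewrite tp in dw dw'.
have d1 := difop_scale oV (ksmooth_pderiv i st) dw.
have d2 := difop_scale oV st dw'.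
apply: eq_difop (difopD (difopD d1 d2) dG') _ => s y sp Vy.
have sw := ksmooth_word t.2 s.
rewrite -(pderivM _ st sw Vy) -(pderivD _ (ksmoothM oV st sw) (ksmooth_difop dG sp) Vy).
by apply: (eq_pderiv _ oV Vy) => z Vz; rewrite FE.
Qed.

Lemma difop_pderivs_comp p w F : difop V p F -> difop V p (fun s => pderivs w (F s)).
Proof. by move=> dF; elim: w => //= i w; exact: difop_pderiv. Qed.

End OnChart.
End DifferentialOperators.

(** * Polydifferential operators *)

Section PolydifferentialOperators.
Context {R : realType} {n : nat} (M : manifold R n) (k : ground).
Local Notation K := (Defs.scalar R k).
Local Notation A := (smooth_fun M k).
Local Notation cochain := (seq A -> A).
Local Notation pd := (@polydifferential R n M k).
Local Notation gins := (@gerstenhaber_ins K A).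
Local Notation br := (insertion_bracket gins).
Local Notation mu := (@mul_cochain R n M k).
Implicit Types (P Q f : cochain) (s : seq A).
Let insP := @gerstenhaber_multilinear K A.

(** The definition with the list of terms hidden in [difop]. *)
Lemma polydifferentialP p P : pd p P <-> is_cochain p P /\
  forall c, atlas c -> forall x, img c x -> exists V : set 'rV[R]_n,
    [/\ open V, V x, V `<=` img c &
        difop c V p (fun s y => (P s : M -> K) (psi c y))].
Proof.
split=> -[cP lP]; split=> // c ac x cx.
  have [V [ts [oV Vx Vc gts PE]]] := lP c ac x cx.
  by exists V; split=> //; apply/difopP; exists ts.
have [V [oV Vx Vc /difopP[ts gts PE]]] := lP c ac x cx.
by exists V, ts; split.
Qed.

Lemma polydifferential_cochain p P : pd p P -> is_cochain p P.
Proof. by case. Qed.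

Lemma polydifferential0 p : pd p 0.
Proof.
apply/polydifferentialP; split=> [|c ac x cx]; first exact: is_cochain0.
exists (img c); split=> //; first exact: img_open (atlas_chart ac).
exact: difop_nil.
Qed.

Lemma polydifferentialL p a P Q : pd p P -> pd p Q -> pd p (a *: P + Q).
Proof.
move=> /polydifferentialP[cP lP] /polydifferentialP[cQ lQ].
apply/polydifferentialP; split=> [|c ac x cx]; first exact: is_cochainL.
have [V [oV Vx Vc dP]] := lP c ac x cx; have [W [oW Wx Wc dQ]] := lQ c ac x cx.
exists (V `&` W); split=> //; first exact: openI.
  by move=> y [Vy _]; exact: Vc.
have dP' := difop_scale (openI oV oW) (ksmooth_cst (V `&` W) a)
  (difop_sub (@subIsetl _ V W) dP).
exact: eq_difop (difopD dP' (difop_sub (@subIsetr _ V W) dQ)) _.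
Qed.

Lemma eval_term_split c (t : @polydiff_term R n k) s1 (f : A) s2 y :
  (size s1 < size t.2)%N ->
  eval_term c t (s1 ++ f :: s2) y =
  t.1 y * (\prod_(wf <- zip (take (size s1) t.2) s1) pderivs wf.1 ((wf.2 : M -> K) \o psi c) y *
    (pderivs (nth [::] t.2 (size s1)) ((f : M -> K) \o psi c) y *
    \prod_(wf <- zip (drop (size s1).+1 t.2) s2) pderivs wf.1 ((wf.2 : M -> K) \o psi c) y)).
Proof.
move=> st; rewrite /eval_term -[in LHS](cat_take_drop (size s1) t.2) (drop_nth [::] st).
by rewrite zip_cat ?size_takel ?(ltnW st) // big_cat /= big_cons.
Qed.

(** In each term of F the inserted value of Q is differentiated along one fixed
    word; the result is a differential operator in the arguments of Q, and it
    multiplies operators in the remaining arguments. *)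
Lemma difop_comp c V p q i (F : seq A -> 'rV[R]_n -> K) Q :
  atlas c -> open V -> V `<=` img c -> (i < p)%N -> difop c V p F ->
  difop c V q (fun s y => (Q s : M -> K) (psi c y)) ->
  difop c V (p + q).-1 (fun s => F (take i s ++ Q (take q (drop i s)) :: drop (i + q) s)).
Proof.
move=> ac oV Vc ip dF dQ.
have sz s : size s = (p + q).-1 -> size (take i s) = i /\
    size (take i s ++ Q (take q (drop i s)) :: drop (i + q) s) = p.
  by move=> sE; rewrite size_cat /= !size_take_min size_drop; lia.
elim: dF => {F} [F F0|t F G [st tp] _ dG FE].
  by apply: difop_nil => s y /sz[_ sE] Vy; exact: F0.
have d1 := @difop_word R n M k c V (take i t.2); rewrite size_takel ?tp ?(ltnW ip) // in d1.
have d2 := difop_pderivs_comp ac oV Vc (nth [::] t.2 i) dQ.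
have d3 := @difop_word R n M k c V (drop i.+1 t.2); rewrite size_drop tp in d3.
have := difop_scale oV st (difop_mul oV d1 (difop_mul oV d2 d3)).
have -> : (i + (q + (p - i.+1)))%N = (p + q).-1 by lia.
move=> /difopD /(_ dG) dt; apply: eq_difop dt _ => s y sE Vy.
have [si szp] := sz s sE; rewrite FE // eval_term_split si ?tp //.
by rewrite drop_drop [(q + i)%N]addnC.
Qed.

(** The two insertions are described on a common neighbourhood, where P and Q are
    both given by local expressions. *)
Lemma polydifferential_ins p q P Q : pd p P -> pd q Q -> forall c, atlas c ->
  forall x, img c x -> exists V : set 'rV[R]_n, [/\ open V, V x, V `<=` img c &
    difop c V (p + q).-1 (fun s y => (gins p q P Q s : M -> K) (psi c y)) /\
    difop c V (q + p).-1 (fun s y => (gins q p Q P s : M -> K) (psi c y))].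
Proof.
move=> /polydifferentialP[cP lP] /polydifferentialP[cQ lQ] c ac x cx.
have [V [oV Vx Vc dP]] := lP c ac x cx; have [W [oW Wx Wc dQ]] := lQ c ac x cx.
have VWc : V `&` W `<=` img c by move=> y [Vy _]; exact: Vc.
have oVW := openI oV oW.
have {}dP := difop_sub (@subIsetl _ V W) dP; have {}dQ := difop_sub (@subIsetr _ V W) dQ.
have insE (p' q' : nat) (P' Q' : cochain) s y : (gins p' q' P' Q' s : M -> K) (psi c y) =
    \sum_(i < p') ((-1) ^+ (i * q'.+1) : K) *
      (P' (take i s ++ Q' (take q' (drop i s)) :: drop (i + q') s) : M -> K) (psi c y).
  rewrite /gerstenhaber_ins.
  elim/big_ind2: _ => // [f1 z1 f2 z2 <- <- //].
have dins (p' q' : nat) (P' Q' : cochain) :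
    difop c (V `&` W) p' (fun s y => (P' s : M -> K) (psi c y)) ->
    difop c (V `&` W) q' (fun s y => (Q' s : M -> K) (psi c y)) ->
    difop c (V `&` W) (p' + q').-1 (fun s y => (gins p' q' P' Q' s : M -> K) (psi c y)).
  move=> dP' dQ'; apply: (@eq_difop _ _ _ _ _ _ _ (fun s y => \sum_(i < p') ((-1) ^+ (i * q'.+1) : K) *
      (P' (take i s ++ Q' (take q' (drop i s)) :: drop (i + q') s) : M -> K) (psi c y))).
    apply: difop_sum => i; apply: (difop_scale oVW (ksmooth_cst _ _)).
    exact: (difop_comp ac oVW VWc (ltn_ord i) dP' dQ').
  by move=> s y _ _; exact: insE.
exists (V `&` W); split=> //; split; exact: dins.
Qed.

Lemma polydifferential_br p q P Q : (0 < p + q)%N -> pd p P -> pd q Q ->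
  pd (p + q).-1 (br P Q).
Proof.
move=> pq hP hQ; have cP := polydifferential_cochain hP; have cQ := polydifferential_cochain hQ.
apply/polydifferentialP; split=> [|c ac x cx].
  exact: (insertion_bracket_cochain insP cP cQ).
have [V [oV Vx Vc [dPQ dQP]]] := polydifferential_ins hP hQ ac cx.
exists V; split=> //; rewrite addnC in dQP.
have dQP' := difop_scale oV (ksmooth_cst V (- (-1) ^+ (p.+1 * q.+1) : K)) dQP.
apply: eq_difop (difopD dPQ dQP') _ => s y sE Vy.
rewrite (insertion_bracketE insP cP cQ); last by rewrite sE prednK.
by rewrite -scaleNr.
Qed.

Lemma polydifferential_mul : pd 2 mu.
Proof.
apply/polydifferentialP; split=> [|c ac x cx].
  split=> [[|a [|b [|d s]]] //= /(_ erefl) //|].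
  move=> [|a [|b [|b' s1]]] [|d [|e s2]] r f g /=; rewrite ?scaler0 ?addr0 //.
    by have [u uE] := smooth_scale_mul M r; rewrite !uE; ring.
  by have [u uE] := smooth_scale_mul M r; rewrite !uE; ring.
have oc := img_open (atlas_chart ac).
exists (img c); split=> //.
have gt : good_term (img c) 2 (cst 1 : 'rV[R]_n -> K, [:: [::]; [::]]).
  by split=> //; exact: ksmooth_cst.
apply: eq_difop (difop_term c gt) _ => -[|a [|b [|]]] // y _ _.
by rewrite /eval_term /= !big_cons big_nil mulr1 mul1r.
Qed.

Lemma gerstenhaber20 P f a : pd 2 P -> pd 0 f ->
  br P f [:: a] = P [:: f [::]; a] - P [:: a; f [::]].
Proof.
move=> /polydifferential_cochain hP /polydifferential_cochain hf.
rewrite (insertion_bracketE insP hP hf) // gerstenhaber_ins20 gerstenhaber_ins0.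
by rewrite scaler0 subr0.
Qed.

Lemma gerstenhaber10 P f : pd 1 P -> pd 0 f -> br P f [::] = P [:: f [::]].
Proof.
move=> /polydifferential_cochain hP /polydifferential_cochain hf.
rewrite (insertion_bracketE insP hP hf) // gerstenhaber_ins10 gerstenhaber_ins0.
by rewrite scaler0 subr0.
Qed.

Lemma gerstenhaber30 P f a b : pd 3 P -> pd 0 f -> br P f [:: a; b] =
  P [:: f [::]; a; b] - P [:: a; f [::]; b] + P [:: a; b; f [::]].
Proof.
move=> /polydifferential_cochain hP /polydifferential_cochain hf.
rewrite (insertion_bracketE insP hP hf) // gerstenhaber_ins30 gerstenhaber_ins0.
by rewrite scaler0 subr0.
Qed.

Lemma gerstenhaber21 P Q a b : pd 2 P -> pd 1 Q -> br P Q [:: a; b] =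
  P [:: Q [:: a]; b] + P [:: a; Q [:: b]] - Q [:: P [:: a; b]].
Proof.
move=> /polydifferential_cochain hP /polydifferential_cochain hQ.
rewrite (insertion_bracketE insP hP hQ) // gerstenhaber_ins21 gerstenhaber_ins12.
by rewrite -signr_odd expr0 scale1r.
Qed.

Lemma gerstenhaber22 P Q a b c : pd 2 P -> pd 2 Q -> br P Q [:: a; b; c] =
  P [:: Q [:: a; b]; c] - P [:: a; Q [:: b; c]] +
  (Q [:: P [:: a; b]; c] - Q [:: a; P [:: b; c]]).
Proof.
move=> /polydifferential_cochain hP /polydifferential_cochain hQ.
rewrite (insertion_bracketE insP hP hQ) // !gerstenhaber_ins22.
by rewrite -signr_odd expr1 scaleN1r opprK.
Qed.

Lemma polydifferential_br20 P f : pd 2 P -> pd 0 f -> pd 1 (br P f).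
Proof. exact: polydifferential_br. Qed.

Lemma polydifferential_br10 P f : pd 1 P -> pd 0 f -> pd 0 (br P f).
Proof. exact: polydifferential_br. Qed.

Lemma polydifferential_br22 P Q : pd 2 P -> pd 2 Q -> pd 3 (br P Q).
Proof. exact: polydifferential_br. Qed.

Lemma polydifferential_derived20 P f g : pd 2 P -> pd 0 f -> pd 0 g ->
  br f (br P g) = - br g (br P f).
Proof.
move=> hP hf hg; have hPf := polydifferential_br20 hP hf.
have hPg := polydifferential_br20 hP hg.
have cf := polydifferential_cochain hf; have cg := polydifferential_cochain hg.
rewrite (insertion_bracket_anti insP cf (polydifferential_cochain hPg)).
rewrite (insertion_bracket_anti insP cg (polydifferential_cochain hPf)).
rewrite sqrrN expr1n !scaleN1r opprK.
have cl := polydifferential_cochain (polydifferential_br10 hPg hf).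
have cr := polydifferential_cochain (polydifferential_br10 hPf hg).
rewrite -scaleN1r -[X in X = _]addr0.
apply: eq_cochain (is_cochainL _ cl (is_cochain0 _)) cr _; case=> // _.
rewrite addr0 scaleN1r; apply/esym; rewrite fctE !gerstenhaber10 // !gerstenhaber20 //.
by rewrite opprB.
Qed.

Lemma polydifferential_jacobi220 P Q f : pd 2 P -> pd 2 Q -> pd 0 f ->
  br P (br Q f) + br Q (br P f) = br (br P Q) f.
Proof.
move=> hP hQ hf; have hPf := polydifferential_br20 hP hf.
have hQf := polydifferential_br20 hQ hf; have hPQ := polydifferential_br22 hP hQ.
have [[cP cQ] cf] := (polydifferential_cochain hP, polydifferential_cochain hQ,
  polydifferential_cochain hf).
have cPf := polydifferential_cochain hPf; have cQf := polydifferential_cochain hQf.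
apply: (@eq_cochain _ _ 2).
- rewrite -[X in X + _]scale1r; apply: is_cochainL.
    exact: (insertion_bracket_cochain insP cP cQf).
  exact: (insertion_bracket_cochain insP cQ cPf).
- exact: (insertion_bracket_cochain insP (polydifferential_cochain hPQ) cf).
case=> [|a [|b [|]]] // _; rewrite [in RHS](gerstenhaber30 _ _ hPQ hf) fctE !gerstenhaber21 //.
rewrite !gerstenhaber22 // !gerstenhaber20 //.
have DB (T : cochain) x y z : is_cochain 2 T -> T [:: x - y; z] = T [:: x; z] - T [:: y; z].
  move=> cT; rewrite (cochain_entryD [::] [:: z] _ _ cT).
  by rewrite (cochain_entryN [::] [:: z] _ cT).
have DB' (T : cochain) x y z : is_cochain 2 T -> T [:: z; x - y] = T [:: z; x] - T [:: z; y].
  move=> cT; rewrite (cochain_entryD [:: z] [::] _ _ cT).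
  by rewrite (cochain_entryN [:: z] [::] _ cT).
rewrite !(DB _ _ _ _ cP) !(DB _ _ _ _ cQ) !(DB' _ _ _ _ cP) !(DB' _ _ _ _ cQ).
ring.
Qed.

(** Commutativity of the product of functions. *)
Lemma hochschild_fun f : pd 0 f -> br mu f = 0.
Proof.
move=> hf; have cB := polydifferential_cochain (polydifferential_br20 polydifferential_mul hf).
apply: (eq_cochain cB (is_cochain0 1)) => -[|a [|]] // _.
rewrite (gerstenhaber20 _ polydifferential_mul hf).
rewrite -[mu [:: f [::]; a]]/(f [::] * a) -[mu [:: a; f [::]]]/(a * f [::]).
by rewrite (mulrC a) subrr.
Qed.

(** The Leibniz rule of the differential on [P, f] is the Jacobi identity of the
    product, P and f, since the product commutes with f. *)
Lemma lower_Dpoly : lower_dgla (Dpoly M k).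
Proof.
apply: (lower_insertion insP (C := pd)).
- exact: polydifferential_cochain.
- exact: polydifferential0.
- exact: polydifferentialL.
- move=> c P Q; exact: (insertion_bracketR insP _ _ _ (polydifferential_cochain polydifferential_mul)).
- by move=> p P hP; exact: (polydifferential_br _ polydifferential_mul hP).
- exact: hochschild_fun.
- exact: polydifferential_br22.
- exact: polydifferential_br20.
- exact: polydifferential_br10.
- exact: polydifferential_derived20.
- exact: polydifferential_jacobi220.
- move=> P f hP hf.
  have := polydifferential_jacobi220 polydifferential_mul hP hf.
  by rewrite (hochschild_fun hf) (insertion_bracket0 insP (polydifferential_cochain hP)) addr0.
Qed.

End PolydifferentialOperators.

(** * The theorem *)

Lemma scalar_char0 (R : realType) (k : ground) m : m.+1%:R != 0 :> Defs.scalar R k.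
Proof. by case: k; rewrite pnatr_eq0. Qed.

Lemma lower_poly_dgla (R : realType) (n : nat) (M : manifold R n) (k : ground)
  (kind : poly_kind) (co : coefficients) : lower_dgla (poly_dgla M k kind co).
Proof.
have LL : lower_dgla (poly_dgla M k kind Plain).
  by case: kind; [exact: lower_Tpoly|exact: lower_Dpoly].
by case: co => //; exact: lower_formal LL.
Qed.

Theorem mainTheorem2 (R : realType) (n : nat) (M : manifold R n) (k : ground)
    (kind : poly_kind) (co : coefficients)
    (tau : graded_topology (poly_dgla M k kind co))
    (pi : poly_dgla M k kind co)
    (X : seq (poly_dgla M k kind co) -> poly_dgla M k kind co)
    (f g : poly_dgla M k kind co) :
  maurer_cartan pi ->
  linf_derivation X ->
  series_converge tau X pi ->
  weak_nijenhuis tau X pi ->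
  homog (-1) f -> homog (-1) g ->
  twisted_diff pi f = 0 -> twisted_diff pi g = 0 ->
  derived_bracket pi (tangent tau X pi (-1) f) (tangent tau X pi (-1) g) = 0.
Proof.
move=> mc hX conv nij hf hg df dg.
exact: (derived_bracket_tangent (lower_poly_dgla M k kind co)
  (@scalar_char0 R k) mc hX conv nij hf df hg dg).
Qed.
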